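(* Let $M^3$ be a Lagrangian submanifold of the homogeneous nearly Kähler sphere $\mathbb S^6(1)$, and in a local oriented orthonormal frame let $h_{ijk;l}$ denote the components of the (tangential, Levi-Civita) covariant derivative of the cubic form $h_{ijk}$. Then $$h_{ijk;l}=T_{lijk}+\tfrac14\sum_m\bigl(\omega_{lim}h_{mjk}+\omega_{ljm}h_{imk}+\omega_{lkm}h_{ijm}\bigr).$$ Moreover, the tensor $T_{lijk}$ is totally symmetric and trace-free.
   Context: Everything is smooth. Identify $\mathbb R^7$ with the imaginary Cayley numbers with cross product $X\times Y=\tfrac12(XY-YX)$. The homogeneous nearly Kähler structure on $\mathbb S^6(1)\subset\mathbb R^7$ is the round metric $\langle\cdot,\cdot\rangle$ with $J_xX=x\times X$. Let $\overline\nabla$ be its Levi-Civita connection and $G(X,Y)=(\overline\nabla_XJ)Y$. A Lagrangian submanifold is an immersed 3-manifold $M^3$ with the induced metric such that $J(TM)=T^\perp M$. Let $\nabla,\nabla^\perp$ be the Levi-Civita and normal connections, $h(X,Y)=\overline\nabla_XY-\nabla_XY$ the second fundamental form, and $A_\xi$ the shape operator, $\langle A_\xi X,Y\rangle=\langle h(X,Y),\xi\rangle$. It is known that $M$ is orientable and minimal and that $G(X,Y)$ is normal for tangent $X,Y$. The form $\omega(X,Y,Z)=\langle G(X,Y),JZ\rangle$ is the volume form of $M$ for a suitable orientation, which is fixed. In a local oriented orthonormal frame $\{e_1,e_2,e_3\}$ of $M$, $\omega_{ijk}=\omega(e_i,e_j,e_k)$ (so $\omega_{123}=1$) and $h_{ijk}=\langle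 h(e_i,e_j),Je_k\rangle$ (known to be totally symmetric and trace-free). The components $h_{ijk;l}$ are those of $\nabla_{e_l}$ applied to the tangential covariant 3-tensor $(X,Y,Z)\mapsto\langle h(X,Y),JZ\rangle$, evaluated on $(e_i,e_j,e_k)$. Set $(\nabla h)(X,Y,Z)=\nabla^\perp_Xh(Y,Z)-h(\nabla_XY,Z)-h(Y,\nabla_XZ)$ and $$T(X,Y,Z)=(\nabla h)(X,Y,Z)-\tfrac14\{G(X,A_{JZ}Y)+G(Y,A_{JX}Z)+G(Z,A_{JY}X)\},$$ $T_{lijk}=\langle T(e_l,e_i,e_j),Je_k\rangle$. *)

(* Defs.v *)
From HB Require Import structures.
From mathcomp Require Import all_boot all_order all_algebra.
From mathcomp Require Import all_fingroup.
From mathcomp Require Import all_classical all_reals all_analysis.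

Set Implicit Arguments.
Unset Strict Implicit.
Unset Printing Implicit Defensive.

Import Order.TTheory GRing.Theory Num.Theory.
Import numFieldNormedType.Exports.

Local Open Scope classical_set_scope.
Local Open Scope ring_scope.

Section Cayley.
Context {R : realType}.

Definition cd_mul (A : zmodType) (mul : A -> A -> A) (conj : A -> A)
    (x y : A * A) : A * A :=
  (mul x.1 y.1 - mul (conj y.2) x.2, mul y.2 x.1 + mul x.2 (conj y.1)).

Definition cd_conj (A : zmodType) (conj : A -> A) (x : A * A) : A * A :=
  (conj x.1, - x.2).

(* The Cayley numbers, obtained from R by three Cayley-Dickson doublings. *)
Definition cplx : Type := (R * R)%type.
Definition quat : Type := (cplx * cplx)%type.
Definition cayley : Type := (quat * quat)%type.

Definition cplx_mul : cplx -> cplx -> cplx := cd_mul (fun a b : R => a * b) id.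
Definition cplx_conj : cplx -> cplx := cd_conj (@id R).
Definition quat_mul : quat -> quat -> quat :=
  @cd_mul (R * R)%type cplx_mul cplx_conj.
Definition quat_conj : quat -> quat := @cd_conj (R * R)%type cplx_conj.
Definition cayley_mul : cayley -> cayley -> cayley :=
  @cd_mul ((R * R) * (R * R))%type quat_mul quat_conj.

Definition coef7 (v : 'rV[R]_7) (k : nat) : R := v 0 (inord k).

Definition of_imag (v : 'rV[R]_7) : cayley :=
  (((0, coef7 v 0), (coef7 v 1, coef7 v 2)),
   ((coef7 v 3, coef7 v 4), (coef7 v 5, coef7 v 6))).

Definition imag (x : cayley) : 'rV[R]_7 :=
  let: (((_, a0), (a1, a2)), ((a3, a4), (a5, a6))) := x in
  \row_(i < 7) nth 0 [:: a0; a1; a2; a3; a4; a5; a6] i.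

Definition cross (u v : 'rV[R]_7) : 'rV[R]_7 :=
  2^-1 *: (imag (cayley_mul (of_imag u) (of_imag v))
           - imag (cayley_mul (of_imag v) (of_imag u))).

Definition dot n (u v : 'rV[R]_n) : R := \sum_(i < n) u 0 i * v 0 i.

End Cayley.

Section Smooth.
Context {R : realType} {V W : normedModType R}.

(* k times continuously differentiable on U; meant for U open and V of finite
   dimension. *)
Fixpoint Ck (k : nat) (U : set V) (f : V -> W) : Prop :=
  if k is k'.+1 then
    (forall x, U x -> differentiable f x) /\
    (forall v : V, Ck k' U (fun x => 'D_v f x))
  else forall x, U x -> {for x, continuous f}.

Definition smooth (U : set V) (f : V -> W) : Prop := forall k, Ck k U f.

End Smooth.

Section Manifold.
Context {R : realType}.

(* Only the values of cmap on cdom and of cinv on the image of cdom matter. *)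
Record chart (n : nat) (M : topologicalType) := Chart {
  cdom : set M;
  cmap : M -> 'rV[R]_n;
  cinv : 'rV[R]_n -> M;
  cdom_open : open cdom;
  cimage_open : open (cmap @` cdom);
  cmapK : forall p, cdom p -> cinv (cmap p) = p;
  cmap_continuous : {within cdom, continuous cmap};
  cinv_continuous : {within cmap @` cdom, continuous cinv} }.

Record smoothManifold (n : nat) := SmoothManifold {
  carrier :> topologicalType;
  carrier_hausdorff : hausdorff_space carrier;
  carrier_second_countable : @second_countable carrier;
  atlas : set (chart n carrier);
  chart_at : carrier -> chart n carrier;
  chart_at_atlas : forall p, atlas (chart_at p);
  mem_chart_at : forall p, cdom (chart_at p) p;
  atlas_smooth : forall c d, atlas c -> atlas d ->
    smooth (cmap c @` (cdom c `&` cdom d)) (cmap d \o cinv c) }.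

Context {n : nat} {M : smoothManifold n}.

Definition msmooth (V : normedModType R) (U : set M) (g : M -> V) : Prop :=
  forall c, atlas c -> smooth (cmap c @` (U `&` cdom c)) (g \o cinv c).

(* The tangent space at p is 'rV[R]_n, a tangent vector being given by its
   components in the chart (chart_at p). *)
Definition mdiff (V : normedModType R) (g : M -> V) (p : M) (v : 'rV[R]_n) : V :=
  'D_v (g \o cinv (chart_at p)) (cmap (chart_at p) p).

(* Smooth vector fields: (mdiff (cmap c) p (X p)) is the vector of components
   of X at p in the chart c. *)
Definition vfield (U : set M) (X : M -> 'rV[R]_n) : Prop :=
  forall c, atlas c ->
    msmooth (U `&` cdom c) (fun p => mdiff (cmap c) p (X p)).

Definition msmooth_at (V : normedModType R) (p : M) (g : M -> V) : Prop :=
  exists U, [/\ open U, U p & msmooth U g].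

Definition vfield_at (p : M) (X : M -> 'rV[R]_n) : Prop :=
  exists U, [/\ open U, U p & vfield U X].

(* (nabla p v Y) is the covariant derivative at p, in the direction v, of a
   vector field Y that is smooth around p; its value is unconstrained when Y is
   not smooth around p. *)
Record levi_civita (g : forall p : M, 'rV[R]_n -> 'rV[R]_n -> R)
    (nabla : forall p : M, 'rV[R]_n -> (M -> 'rV[R]_n) -> 'rV[R]_n) : Prop := {
  lc_linear : forall p a u v Y, vfield_at p Y ->
    nabla p (a *: u + v) Y = a *: nabla p u Y + nabla p v Y;
  lc_add : forall p v Y Z, vfield_at p Y -> vfield_at p Z ->
    nabla p v (fun q => Y q + Z q) = nabla p v Y + nabla p v Z;
  lc_leibniz : forall p v (phi : M -> R) Y, msmooth_at p phi -> vfield_at p Y ->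
    nabla p v (fun q => phi q *: Y q) =
    mdiff phi p v *: Y p + phi p *: nabla p v Y;
  lc_smooth : forall U X Y, open U -> vfield U X -> vfield U Y ->
    vfield U (fun q => nabla q (X q) Y);
  lc_torsion_free : forall p X Y (phi : M -> R),
    vfield_at p X -> vfield_at p Y -> msmooth_at p phi ->
    mdiff phi p (nabla p (X p) Y - nabla p (Y p) X) =
    mdiff (fun q => mdiff phi q (Y q)) p (X p)
    - mdiff (fun q => mdiff phi q (X q)) p (Y p);
  lc_metric : forall p v Y Z, vfield_at p Y -> vfield_at p Z ->
    mdiff (fun q => g q (Y q) (Z q)) p v =
    g p (nabla p v Y) (Z p) + g p (Y p) (nabla p v Z) }.

End Manifold.

Section Sphere.
Context {R : realType}.
Implicit Types (x u v w : 'rV[R]_7) (U : set 'rV[R]_7) (X Y Z : 'rV[R]_7 -> 'rV[R]_7).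

Definition S6 : set 'rV[R]_7 := [set x | dot x x = 1].

(* A vector field on an open subset of the sphere is represented by a smooth
   map on an open subset U of R^7 whose values on the sphere are tangent to it;
   its values off the sphere are irrelevant. *)
Definition sphere_vfield U Y : Prop :=
  smooth U Y /\ forall x, U x -> S6 x -> dot x (Y x) = 0.

Definition sphere_vfield_at x Y : Prop :=
  exists U, [/\ open U, U x & sphere_vfield U Y].

(* The Levi-Civita connection of the round metric; (D x v Y) is the covariant
   derivative of Y at the point x of the sphere in the direction v. *)
Record sphere_levi_civita
    (D : 'rV[R]_7 -> 'rV[R]_7 -> ('rV[R]_7 -> 'rV[R]_7) -> 'rV[R]_7) : Prop := {
  slc_tangent : forall x v Y, S6 x -> dot x v = 0 -> sphere_vfield_at x Y ->
    dot x (D x v Y) = 0;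
  slc_restrict : forall x v U Y Z, S6 x -> dot x v = 0 -> open U -> U x ->
    sphere_vfield U Y -> sphere_vfield U Z ->
    (forall y, U y -> S6 y -> Y y = Z y) -> D x v Y = D x v Z;
  slc_linear : forall x a u v Y, S6 x -> dot x u = 0 -> dot x v = 0 ->
    sphere_vfield_at x Y ->
    D x (a *: u + v) Y = a *: D x u Y + D x v Y;
  slc_add : forall x v Y Z, S6 x -> dot x v = 0 ->
    sphere_vfield_at x Y -> sphere_vfield_at x Z ->
    D x v (fun y => Y y + Z y) = D x v Y + D x v Z;
  slc_leibniz : forall x v U (phi : 'rV[R]_7 -> R) Y, S6 x -> dot x v = 0 ->
    open U -> U x -> smooth U phi -> sphere_vfield_at x Y ->
    D x v (fun y => phi y *: Y y) = 'D_v phi x *: Y x + phi x *: D x v Y;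
  slc_smooth : forall x U X Y, S6 x -> open U -> U x ->
    sphere_vfield U X -> sphere_vfield U Y ->
    exists U' Z, [/\ open U', U' x, sphere_vfield U' Z &
      forall y, U' y -> S6 y -> Z y = D y (X y) Y];
  slc_torsion_free : forall x U X Y (phi : 'rV[R]_7 -> R), S6 x ->
    sphere_vfield_at x X -> sphere_vfield_at x Y ->
    open U -> U x -> smooth U phi ->
    'D_(D x (X x) Y - D x (Y x) X) phi x =
    'D_(X x) (fun y => 'D_(Y y) phi y) x - 'D_(Y x) (fun y => 'D_(X y) phi y) x;
  slc_metric : forall x v Y Z, S6 x -> dot x v = 0 ->
    sphere_vfield_at x Y -> sphere_vfield_at x Z ->
    'D_v (fun y => dot (Y y) (Z y)) x = dot (D x v Y) (Z x) + dot (Y x) (D x v Z) }.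

Variable D : 'rV[R]_7 -> 'rV[R]_7 -> ('rV[R]_7 -> 'rV[R]_7) -> 'rV[R]_7.

(* The almost complex structure is J_x = cross x.  The tensor G is the covariant
   derivative of J, (D_u J) w = D_u (J Y) - J (D_u Y), for any vector field Y
   with value w at x. *)
Definition nkG x u w : 'rV[R]_7 :=
  get [set z | forall Y, sphere_vfield_at x Y -> Y x = w ->
    z = D x u (fun y => cross y (Y y)) - cross x (D x u Y)].

End Sphere.

Section Submanifold.
Context {R : realType} {M : smoothManifold (R := R) 3}.
Implicit Types (p q : M) (X Y Z : M -> 'rV[R]_3) (xi : M -> 'rV[R]_7).

Definition sphere_immersion (f : M -> 'rV[R]_7) : Prop :=
  [/\ msmooth setT f, forall p, S6 (f p) & forall p, injective (mdiff f p)].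

Variable f : M -> 'rV[R]_7.

Definition induced_metric p (v w : 'rV[R]_3) : R := dot (mdiff f p v) (mdiff f p w).

Definition push X : M -> 'rV[R]_7 := fun p => mdiff f p (X p).

Definition pushJ X : M -> 'rV[R]_7 := fun p => cross (f p) (mdiff f p (X p)).

(* The normal space of M in S^6. *)
Definition normal_space p : set 'rV[R]_7 :=
  [set u | dot (f p) u = 0 /\ forall v, dot (mdiff f p v) u = 0].

Definition lagrangian : Prop :=
  forall p, [set cross (f p) (mdiff f p v) | v in setT] = normal_space p.

(* Vector fields of S^6 along f, i.e. sections of the pullback of T S^6. *)
Definition along (U : set M) (V : M -> 'rV[R]_7) : Prop :=
  msmooth U V /\ forall p, U p -> dot (f p) (V p) = 0.

Definition along_at p (V : M -> 'rV[R]_7) : Prop :=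
  exists U, [/\ open U, U p & along U V].

(* Dbar is the pullback by f of the connection D of S^6: it differentiates
   vector fields along f in directions tangent to M. *)
Record pullback_connection
    (D : 'rV[R]_7 -> 'rV[R]_7 -> ('rV[R]_7 -> 'rV[R]_7) -> 'rV[R]_7)
    (Dbar : M -> 'rV[R]_3 -> (M -> 'rV[R]_7) -> 'rV[R]_7) : Prop := {
  pc_tangent : forall p v V, along_at p V -> dot (f p) (Dbar p v V) = 0;
  pc_linear : forall p a u v V, along_at p V ->
    Dbar p (a *: u + v) V = a *: Dbar p u V + Dbar p v V;
  pc_add : forall p v V V', along_at p V -> along_at p V' ->
    Dbar p v (fun q => V q + V' q) = Dbar p v V + Dbar p v V';
  pc_leibniz : forall p v (phi : M -> R) V, msmooth_at p phi -> along_at p V ->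
    Dbar p v (fun q => phi q *: V q) =
    mdiff phi p v *: V p + phi p *: Dbar p v V;
  pc_smooth : forall U X V, open U -> vfield U X -> along U V ->
    along U (fun q => Dbar q (X q) V);
  pc_pullback : forall p v (Y : 'rV[R]_7 -> 'rV[R]_7),
    sphere_vfield_at (f p) Y ->
    Dbar p v (Y \o f) = D (f p) (mdiff f p v) Y }.

Variable D : 'rV[R]_7 -> 'rV[R]_7 -> ('rV[R]_7 -> 'rV[R]_7) -> 'rV[R]_7.
Variable Dbar : M -> 'rV[R]_3 -> (M -> 'rV[R]_7) -> 'rV[R]_7.
Variable nabla : forall p : M, 'rV[R]_3 -> (M -> 'rV[R]_3) -> 'rV[R]_3.

Definition nablaF X Y : M -> 'rV[R]_3 := fun p => nabla p (X p) Y.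

Definition sff X Y : M -> 'rV[R]_7 :=
  fun p => Dbar p (X p) (push Y) - push (nablaF X Y) p.

(* The normal component of the derivative of a normal field. *)
Definition nabla_perp X xi : M -> 'rV[R]_7 := fun p =>
  get [set z | normal_space p z /\ exists w, Dbar p (X p) xi = mdiff f p w + z].

(* (sff X Y p) depends only on X p and Y p, so that a is unique. *)
Definition shape_op xi X : M -> 'rV[R]_3 := fun p =>
  get [set a | forall Y, vfield_at p Y ->
    induced_metric p a (Y p) = dot (sff X Y p) (xi p)].

Definition Gf X Y : M -> 'rV[R]_7 := fun p => nkG D (f p) (push X p) (push Y p).

Definition omega X Y Z : M -> R := fun p => dot (Gf X Y p) (pushJ Z p).

Definition cubic X Y Z : M -> R := fun p => dot (sff X Y p) (pushJ Z p).

(* The covariant derivative of the cubic form in the direction X. *)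
Definition nabla_cubic X Y1 Y2 Y3 : M -> R := fun p =>
  mdiff (cubic Y1 Y2 Y3) p (X p)
  - cubic (nablaF X Y1) Y2 Y3 p - cubic Y1 (nablaF X Y2) Y3 p
  - cubic Y1 Y2 (nablaF X Y3) p.

Definition nabla_sff X Y Z : M -> 'rV[R]_7 := fun p =>
  nabla_perp X (sff Y Z) p - sff (nablaF X Y) Z p - sff Y (nablaF X Z) p.

Definition tensorT X Y Z : M -> 'rV[R]_7 := fun p =>
  nabla_sff X Y Z p
  - 4^-1 *: (Gf X (shape_op (pushJ Z) Y) p + Gf Y (shape_op (pushJ X) Z) p
             + Gf Z (shape_op (pushJ Y) X) p).

Definition tensorT4 X Y Z V : M -> R := fun p => dot (tensorT X Y Z p) (pushJ V p).

(* The orientation of M is the one for which omega is positive. *)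
Definition oriented_orthonormal_frame (U : set M) (e : 'I_3 -> M -> 'rV[R]_3) : Prop :=
  [/\ forall i, vfield U (e i),
      forall p, U p -> forall i j, induced_metric p (e i p) (e j p) = (i == j)%:R &
      forall p, U p -> 0 < omega (e 0) (e 1) (e 2) p].

End Submanifold.

(* The array t consists of the components of a 4-tensor on a 3-space. *)
Definition totally_symmetric (R : realType) (t : 'I_3 -> 'I_3 -> 'I_3 -> 'I_3 -> R) :=
  forall (s : 'S_4) (a : 'I_4 -> 'I_3),
    t (a (s 0)) (a (s 1)) (a (s 2)) (a (s 3)) = t (a 0) (a 1) (a 2) (a 3).

(* For a totally symmetric array all the contractions coincide. *)
Definition trace_free (R : realType) (t : 'I_3 -> 'I_3 -> 'I_3 -> 'I_3 -> R) :=
  forall j k, \sum_m t m m j k = 0.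

(* Main.v *)
(* Along the immersion f, with F_i = df(e_i) and N_i = f x F_i, the Levi-Civita
   connections are tangential parts of the flat derivative d of R^7, and
   h_ijk = <d_i F_j, N_k>.  Differentiating <f x F_i, F_j> = 0 gives
   <F_l x F_i, F_j> = h_lij - h_lji; the left side is alternating and h_lij is
   symmetric in l, i, so both sides vanish and h is totally symmetric.
   Differentiating <F_i x F_j, F_k> = 0 then gives the cyclic identity
     sum_m (h_lim w_jkm + h_ljm w_kim + h_lkm w_ijm) = 0,
   whose case (i, j, k) = (0, 1, 2) says that h is trace-free.  Since
   d_l N_k = F_l x F_k + f x d_l F_k, one finds
     h_ijk;l = <(nabla h)(e_l, e_i, e_j), N_k> + sum_m h_ijm w_lkm,
   and two instances of the cyclic identity turn this into the formula.  By the
   formula T_lijk is symmetric in i, j, k, and the Codazzi equation gives the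
   symmetry in l, i; tracing the formula over i = j shows that T is trace-free. *)

Require Import Defs.
From HB Require Import structures.
From mathcomp Require Import all_boot all_order all_algebra.
From mathcomp Require Import all_fingroup.
From mathcomp Require Import all_classical all_reals all_analysis.
From mathcomp Require Import ring.

Set Implicit Arguments.
Unset Strict Implicit.
Unset Printing Implicit Defensive.

Import Order.TTheory GRing.Theory Num.Theory.
Import numFieldNormedType.Exports.

Local Open Scope classical_set_scope.
Local Open Scope ring_scope.

(** * Calculus of [Ck] maps *)

Section Differentiation.
Context {R : realType} {V W : normedModType R}.
Implicit Types (f g : V -> W) (k h : V -> R).

(** The connections [D], [Dbar] and [nabla] are known only through their axioms, so each must be
    tied to the flat derivative of R^7 before anything can be computed. For [D] and [Dbar] a field
    is expanded in the gradients of the seven coordinate functions, which span every tangent space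
    of the sphere: [D] is determined on them by the uniqueness argument for Levi-Civita connections,
    and Leibniz' rule does the rest. For [nabla] no formula is derived; the same uniqueness argument
    shows directly that [sff] is normal. The tensor T is the total symmetrization of h_ijk;l: each
    summand of the correction is skew in l and one of i, j, k, hence symmetrizes to zero. As h_ijk;l
    is already symmetric in i, j, k, symmetrizing it amounts to averaging over which of the four
    indices carries the derivative, which is the origin of the factor 1/4. *)

Lemma differentiable_near_eq f g x :
  (\forall y \near x, f y = g y) -> differentiable f x -> differentiable g x.
Proof.
move=> fg df.
have dh : differentiable (g - f) x.
  (* The difference vanishes near [x], so its expansion with differential zero has no remainder
     there. *)
  have H : (g - f) \o shift x = cst ((g - f) x) + (\0 : {linear V -> W}) +o_ 0 id.
    have h0 : (g - f) x = 0 by rewrite !fctE (nbhs_singleton fg) subrr.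
    apply/eqaddoP => _/posnumP[eps]; near=> y.
    suff -> : ((g - f) \o shift x - (cst ((g - f) x) + (\0 : {linear V -> W}))) y = 0.
      by rewrite normr0 mulr_ge0.
    have gf : f (y + x) = g (y + x).
      near: y; move: fg; rewrite (near_shift 0 x) subr0.
      by [].
    rewrite -[LHS]/(g (y + x) - f (y + x) - ((g x - f x) + 0)).
    by rewrite -gf (nbhs_singleton fg) !subrr addr0 subr0.
  have c0 : continuous (\0 : {linear V -> W}) by move=> y; exact: cst_continuous.
  by apply/diff_locallyP; rewrite (diff_unique c0 H).
have -> : g = f + (g - f) by rewrite addrC subrK.
exact: differentiableD.
Unshelve. all: by end_near. Qed.

Lemma derive_linear f x a u v : differentiable f x ->
  'D_(a *: u + v) f x = a *: 'D_u f x + 'D_v f x.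
Proof. by move=> df; rewrite !deriveE// linearP. Qed.

Lemma derive_scalel k (w : W) x v : differentiable k x ->
  'D_v (fun y => k y *: w) x = 'D_v k x *: w.
Proof.
move=> dk; rewrite deriveE; last exact: differentiableZl.
by rewrite diffZl// deriveE.
Qed.

Lemma derive_mul h k x v : differentiable h x -> differentiable k x ->
  'D_v (fun y => h y * k y) x = 'D_v h x * k x + h x * 'D_v k x.
Proof.
move=> dh dk; rewrite (deriveM (diff_derivable dh) (diff_derivable dk)).
by rewrite addrC; congr (_ + _); exact: mulrC.
Qed.

Lemma derive_fsum (I : Type) (s : seq I) (F : I -> V -> W) x v :
  (forall i, differentiable (F i) x) ->
  differentiable (fun y => \sum_(i <- s) F i y) x /\
  'D_v (fun y => \sum_(i <- s) F i y) x = \sum_(i <- s) 'D_v (F i) x.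
Proof.
move=> dF; elim: s => [|i s [IH1 IH2]].
  rewrite big_nil (_ : (fun _ => _) = cst 0); last first.
    by apply/funext => y; rewrite big_nil.
  by split; [exact: differentiable_cst|exact: derive_cst].
rewrite big_cons (_ : (fun _ => _) = F i + (fun y => \sum_(i <- s) F i y)); last first.
  by apply/funext => y; rewrite big_cons.
split; first exact: differentiableD.
by rewrite deriveD ?IH2//; exact: diff_derivable.
Qed.

End Differentiation.

Section Coordinates.
Context {R : realType} {V : normedModType R} {n : nat}.
Implicit Types F : V -> 'rV[R]_n.

Lemma rowE_delta (u : 'rV[R]_n) : u = \sum_i u 0 i *: delta_mx 0 i.
Proof. by rewrite [LHS]row_sum_delta. Qed.

Lemma differentiable_coord_comp F i x :
  differentiable F x -> differentiable (fun y => F y 0 i) x.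
Proof. by move=> dF; exact: (differentiable_comp dF (differentiable_coord (F x) 0 i)). Qed.

Lemma derive_coord F i x v : differentiable F x ->
  'D_v (fun y => F y 0 i) x = ('D_v F x) 0 i.
Proof. by move=> dF; rewrite derive_mx ?mxE//; exact: diff_derivable. Qed.

Lemma derive_sum_delta (W : normedModType R) (g : 'rV[R]_n -> W) y v :
  differentiable g y -> 'D_v g y = \sum_i v 0 i *: 'D_(delta_mx 0 i) g y.
Proof.
move=> dg; rewrite deriveE// {1}(rowE_delta v) linear_sum.
by apply: eq_bigr => i _; rewrite linearZ deriveE.
Qed.

End Coordinates.

Section Bilinear.
Context {R : realType} {m n : nat} {W : normedModType R}.

(** Bilinearity is encoded by a table of coefficients, so that differentiability and smoothness of a
    product reduce to those of products of coordinates. It covers [dot], [cross] and scaling by a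
    coordinate alike. *)
Definition bilinear_form (B : 'rV[R]_m -> 'rV[R]_n -> W) : Prop :=
  exists c : 'I_m -> 'I_n -> W, forall u v,
    B u v = \sum_(i : 'I_m * 'I_n) (u 0 i.1 * v 0 i.2) *: c i.1 i.2.

Variable B : 'rV[R]_m -> 'rV[R]_n -> W.
Hypothesis HB : bilinear_form B.

Lemma derive_bilinear (V : normedModType R) (F : V -> 'rV[R]_m) (G : V -> 'rV[R]_n)
    x v : differentiable F x -> differentiable G x ->
  differentiable (fun y => B (F y) (G y)) x /\
  'D_v (fun y => B (F y) (G y)) x = B ('D_v F x) (G x) + B (F x) ('D_v G x).
Proof.
move=> dF dG; have [c Hc] := HB.
have -> : (fun y => B (F y) (G y)) =
    (fun y => \sum_(i : 'I_m * 'I_n) (F y 0 i.1 * G y 0 i.2) *: c i.1 i.2).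
  by apply/funext => y.
have dM (i : 'I_m * 'I_n) : differentiable (fun y => F y 0 i.1 * G y 0 i.2) x.
  exact: (differentiableM (differentiable_coord_comp _ dF) (differentiable_coord_comp _ dG)).
have dZ (i : 'I_m * 'I_n) :
    differentiable (fun y => (F y 0 i.1 * G y 0 i.2) *: c i.1 i.2) x.
  exact: differentiableZl.
have [d1 d2] := derive_fsum (index_enum _) v dZ; split=> //.
rewrite d2 !Hc -big_split; apply: eq_bigr => i _ /=.
rewrite derive_scalel// derive_mul; try exact: differentiable_coord_comp.
by rewrite !derive_coord// scalerDl.
Qed.

End Bilinear.

(** * Closure properties of [Ck] on open sets *)

Section Smooth.
Context {R : realType} {V W : normedModType R}.
Implicit Types (f g : V -> W) (A : set V).

(** On an open set, equality at every point is equality near every point, so it passes to all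
    derivatives. The closure lemmas use it to replace a derivative by its Leibniz expansion. *)
Lemma Ck_eq k A f g : open A -> (forall x, A x -> f x = g x) ->
  Ck k A f -> Ck k A g.
Proof.
move=> oA; elim: k f g => [|k IH] f g fg /=.
  move=> cf x Ax; have nfg : \forall y \near x, f y = g y.
    by have := open_nbhs_nbhs (conj oA Ax); apply: filterS => y /fg.
  suff : g y @[y --> x] --> g x by [].
  rewrite -[X in _ --> X](fg _ Ax); apply: cvg_trans (cf x Ax).
  exact: near_eq_cvg.
move=> [df cf]; have nfg x : A x -> \forall y \near x, f y = g y.
  by move=> Ax; have := open_nbhs_nbhs (conj oA Ax); apply: filterS => y /fg.
split=> [x Ax|v]; first exact: differentiable_near_eq (nfg _ Ax) (df x Ax).
by apply: IH (cf v) => x Ax; apply: near_eq_derive; exact: nfg.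
Qed.

Lemma Ck_sub k A B f : A `<=` B -> Ck k B f -> Ck k A f.
Proof.
move=> AB; elim: k f => [|k IH] f /=; first by move=> cf x /AB; exact: cf.
by move=> [df cf]; split=> [x /AB|v]; [exact: df|exact: IH].
Qed.

Lemma Ck_pred k A f : Ck k.+1 A f -> Ck k A f.
Proof.
elim: k f => [|k IH] f /=.
  by move=> [df _] x Ax; exact: (differentiable_continuous (df x Ax)).
by move=> [df cf]; split=> // v; apply: IH; exact: cf.
Qed.

Lemma Ck_cst k A (w : W) : Ck k A (cst w).
Proof.
elim: k w => [|k IH] w /=; first by move=> x _; exact: cst_continuous.
split=> [x _|v]; first exact: differentiable_cst.
by rewrite (_ : (fun x => _) = cst 0)//; apply/funext => x; rewrite derive_cst.
Qed.

Lemma CkD k A f g : open A -> Ck k A f -> Ck k A g -> Ck k A (fun x => f x + g x).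
Proof.
move=> oA; elim: k f g => [|k IH] f g /=.
  by move=> cf cg x Ax; exact: (continuousD (cf x Ax) (cg x Ax)).
move=> [df cf] [dg cg]; split=> [x Ax|v]; first exact: (differentiableD (df x Ax) (dg x Ax)).
apply: Ck_eq (IH _ _ (cf v) (cg v)) => // x Ax.
by rewrite (deriveD (diff_derivable (df x Ax)) (diff_derivable (dg x Ax))).
Qed.

Lemma Ck_sum (I : Type) (s : seq I) (F : I -> V -> W) k A : open A ->
  (forall i, Ck k A (F i)) -> Ck k A (fun x => \sum_(i <- s) F i x).
Proof.
move=> oA cF; elim: s => [|i s IH].
  by rewrite (_ : (fun _ => _) = cst 0); [exact: Ck_cst|apply/funext => y; rewrite big_nil].
rewrite (_ : (fun _ => _) = (fun y => F i y + \sum_(i <- s) F i y)); first exact: CkD.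
by apply/funext => y; rewrite big_cons.
Qed.

Lemma Ck_scalel k A (h : V -> R) (w : W) : open A -> Ck k A h -> Ck k A (fun x => h x *: w).
Proof.
move=> oA; elim: k h => [|k IH] h /=.
  by move=> ch x Ax; exact: (continuousZr_tmp (ch x Ax)).
move=> [dh ch]; split=> [x Ax|v]; first by apply: differentiableZl; exact: dh.
by apply: Ck_eq (IH _ (ch v)) => // x Ax; rewrite derive_scalel//; exact: dh.
Qed.

End Smooth.

Section SmoothProducts.
Context {R : realType} {V : normedModType R}.

Lemma CkM k (A : set V) (h l : V -> R) : open A -> Ck k A h -> Ck k A l ->
  Ck k A (fun x => h x * l x).
Proof.
move=> oA; elim: k h l => [|k IH] h l.
  by move=> ch cl x Ax; exact: (continuousM (ch x Ax) (cl x Ax)).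
(* Leibniz' rule pairs a derivative with an undifferentiated factor, so the induction hypothesis is
   also needed for the factors at the lower order. *)
move=> ch cl; have ch' := Ck_pred ch; have cl' := Ck_pred cl.
move: ch cl => /= [dh ch] [dl cl]; split=> [x Ax|v].
  exact: (differentiableM (dh x Ax) (dl x Ax)).
apply: (@Ck_eq _ _ _ _ _ (fun x => 'D_v h x * l x + h x * 'D_v l x)) => //.
  by move=> x Ax; rewrite derive_mul//; [exact: dh|exact: dl].
by apply: CkD => //; exact: IH.
Qed.

Lemma Ck_coord n k (A : set V) (F : V -> 'rV[R]_n) i : open A ->
  Ck k A F -> Ck k A (fun x => F x 0 i).
Proof.
move=> oA; elim: k F => [|k IH] F /=.
  move=> cF x Ax; apply: (@continuous_comp _ _ _ F (fun u : 'rV[R]_n => u 0 i)).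
    exact: cF.
  exact: coord_continuous.
move=> [dF cF]; split=> [x Ax|v]; first exact: differentiable_coord_comp (dF x Ax).
by apply: Ck_eq (IH _ (cF v)) => // x Ax; rewrite derive_coord//; exact: dF.
Qed.

Lemma Ck_rV n k (A : set V) (F : V -> 'rV[R]_n) : open A ->
  (forall i, Ck k A (fun x => F x 0 i)) -> Ck k A F.
Proof.
move=> oA cF; rewrite (_ : F = fun y => \sum_i F y 0 i *: delta_mx 0 i).
  by apply: Ck_sum => // i; exact: Ck_scalel.
by apply/funext => y; rewrite -rowE_delta.
Qed.

Lemma Ck_bilinear m n (W : normedModType R) (B : 'rV[R]_m -> 'rV[R]_n -> W) k
    (A : set V) F G : bilinear_form B -> open A ->
  Ck k A F -> Ck k A G -> Ck k A (fun x => B (F x) (G x)).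
Proof.
move=> [c Hc] oA cF cG.
rewrite (_ : (fun x => _) = fun x => 
    \sum_(i : 'I_m * 'I_n) (F x 0 i.1 * G x 0 i.2) *: c i.1 i.2).
  apply: Ck_sum => // i; apply: Ck_scalel => //.
  by apply: CkM => //; exact: Ck_coord.
by apply/funext => y.
Qed.

Lemma Ck_scale n k (A : set V) (h : V -> R) (F : V -> 'rV[R]_n) : open A ->
  Ck k A h -> Ck k A F -> Ck k A (fun x => h x *: F x).
Proof.
move=> oA ch cF; apply: Ck_rV => // i.
rewrite (_ : (fun x => _) = fun x => h x * F x 0 i); last by apply/funext => x; rewrite mxE.
by apply: CkM => //; exact: Ck_coord.
Qed.

Lemma CkN n k (A : set V) (F : V -> 'rV[R]_n) : open A ->
  Ck k A F -> Ck k A (fun x => - F x).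
Proof.
move=> oA cF; rewrite (_ : (fun x => _) = fun x => (-1) *: F x).
  by apply: Ck_scale => //; exact: Ck_cst.
by apply/funext => x; rewrite scaleN1r.
Qed.

Lemma Ck_id k (A : set V) : Ck k A id.
Proof.
case: k => [|k] /=; first by move=> x _.
split=> [x _|v]; first exact: ex_diff.
rewrite (_ : (fun x => _) = cst v); first exact: Ck_cst.
by apply/funext => x; rewrite derive_id.
Qed.

End SmoothProducts.

(** * Calculus on manifolds *)

Lemma smooth_differentiable (R : realType) (V W : normedModType R) (A : set V)
  (g : V -> W) x : smooth A g -> A x -> differentiable g x.
Proof. by move=> /(_ 1%N) [dg _] Ax; exact: dg. Qed.

Lemma derive_comp_eq (R : realType) (U V W : normedModType R) (f : U -> V) (g : V -> W)
  x v y : f x = y -> differentiable f x -> differentiable g y ->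
  'D_v (g \o f) x = 'D_('D_v f x) g y.
Proof.
move=> <- df dg; rewrite deriveE; last exact: differentiable_comp.
by rewrite diff_comp// [in RHS]deriveE// deriveE.
Qed.

Section ManifoldCalculus.
Context {R : realType} {n : nat} {M : smoothManifold (R := R) n}.
Implicit Types (c d : chart (R := R) n M) (p q : M) (U : set M).

Lemma cinv_near c p (P : set M) : cdom c p ->
  (\forall q \near p, P q) -> \forall y \near cmap c p, P (cinv c y).
Proof.
move=> cp Pp; have Ip : (cmap c @` cdom c) (cmap c p) by exists p.
have := @cinv_continuous _ _ _ c.
rewrite continuous_open_subspace; last exact: cimage_open.
move=> /(_ _ (mem_set Ip)); rewrite /continuous_at cmapK// => /(_ _ Pp).
exact.
Qed.

Lemma cimage_near c p : cdom c p -> \forall y \near cmap c p, (cmap c @` cdom c) y.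
Proof.
by move=> cp; apply: open_nbhs_nbhs; split; [exact: cimage_open|exists p].
Qed.

Lemma open_chart_image U c : open U -> open (cmap c @` (U `&` cdom c)).
Proof.
move=> oU; rewrite openE => _ [p [Up cp] <-].
have nU : \forall q \near p, U q by exact: open_nbhs_nbhs.
near=> y.
have [q cq qy] : (cmap c @` cdom c) y by near: y; exact: cimage_near.
exists q => //; split=> //; rewrite -[q](cmapK cq) qy; near: y.
exact: cinv_near.
Unshelve. all: by end_near. Qed.

Lemma msmooth_differentiable (V : normedModType R) U (g : M -> V) c p :
  msmooth U g -> U p -> atlas c -> cdom c p -> differentiable (g \o cinv c) (cmap c p).
Proof. by move=> sg Up ac cp; apply: smooth_differentiable (sg c ac) _; exists p. Qed.

(** The chart is the one in which [mdiff] is computed, so the pointwise rules for [mdiff] are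
    instances of those for [derive]. *)
Definition mdifferentiable (V : normedModType R) p (g : M -> V) : Prop :=
  differentiable (g \o cinv (chart_at p)) (cmap (chart_at p) p).

Lemma msmooth_at_differentiable (V : normedModType R) p (g : M -> V) :
  msmooth_at p g -> mdifferentiable p g.
Proof.
move=> [U [oU Up sg]]; apply: msmooth_differentiable sg Up _ _.
  exact: chart_at_atlas.
exact: mem_chart_at.
Qed.

Lemma mdiff_near_eq (V : normedModType R) (g g' : M -> V) p v :
  (\forall q \near p, g q = g' q) -> mdiff g p v = mdiff g' p v.
Proof.
by move=> gg; apply: near_eq_derive; apply: (cinv_near (mem_chart_at p) gg).
Qed.

(* Chain rule for the transition map from [chart_at p] to [c]. *)
Lemma mdiff_chart (V : normedModType R) (g : M -> V) c p v : atlas c -> cdom c p ->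
  differentiable (g \o cinv c) (cmap c p) ->
  mdiff g p v = 'D_(mdiff (cmap c) p v) (g \o cinv c) (cmap c p).
Proof.
move=> ac cp dg; set d := chart_at p.
have dp : cdom d p := mem_chart_at p.
have dt : differentiable (cmap c \o cinv d) (cmap d p).
  apply: (smooth_differentiable (atlas_smooth (chart_at_atlas p) ac)).
  by exists p.
have E : (cmap c \o cinv d) (cmap d p) = cmap c p by rewrite /= cmapK.
have -> : mdiff g p v = 'D_v ((g \o cinv c) \o (cmap c \o cinv d)) (cmap d p).
  apply: near_eq_derive; near=> y => /=; rewrite cmapK//; near: y.
  apply: (@cinv_near d p (cdom c)) => //; apply: open_nbhs_nbhs; split=> //.
  exact: cdom_open.
exact: (derive_comp_eq v E).
Unshelve. all: by end_near. Qed.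

Section Closure.
Variables (U : set M) (oU : open U).

Lemma msmooth_eq (V : normedModType R) (g g' : M -> V) :
  (forall q, U q -> g q = g' q) -> msmooth U g -> msmooth U g'.
Proof.
move=> gg sg c ac k; apply: Ck_eq (sg c ac k); first exact: open_chart_image.
by move=> _ [q [Uq cq] <-] /=; rewrite cmapK// gg.
Qed.

Lemma msmooth_sub (V : normedModType R) (U' : set M) (g : M -> V) :
  U `<=` U' -> msmooth U' g -> msmooth U g.
Proof.
move=> UU sg c ac k; apply: Ck_sub (sg c ac k) => _ [q [Uq cq] <-].
by exists q => //; split=> //; exact: UU.
Qed.

Lemma msmooth_cst (V : normedModType R) (w : V) : msmooth U (cst w : M -> V).
Proof. by move=> c ac k; exact: Ck_cst. Qed.

Lemma msmoothD (V : normedModType R) (g g' : M -> V) :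
  msmooth U g -> msmooth U g' -> msmooth U (fun q => g q + g' q).
Proof.
by move=> sg sg' c ac k; apply: (CkD _ (sg c ac k) (sg' c ac k)); exact: open_chart_image.
Qed.

Lemma msmooth_scale m (h : M -> R) (F : M -> 'rV[R]_m) :
  msmooth U h -> msmooth U F -> msmooth U (fun q => h q *: F q).
Proof.
by move=> sh sF c ac k; apply: (Ck_scale _ (sh c ac k) (sF c ac k)); exact: open_chart_image.
Qed.

Lemma msmoothN m (F : M -> 'rV[R]_m) : msmooth U F -> msmooth U (fun q => - F q).
Proof.
by move=> sF c ac k; apply: (CkN _ (sF c ac k)); exact: open_chart_image.
Qed.

Lemma msmooth_coord m (F : M -> 'rV[R]_m) i : msmooth U F -> msmooth U (fun q => F q 0 i).
Proof.
by move=> sF c ac k; apply: (Ck_coord i _ (sF c ac k)); exact: open_chart_image.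
Qed.

(** The chart and the direction in [mdiff] both vary with the point. In a fixed chart [c] the
    derivative becomes a combination of partial derivatives of [g \o cinv c], whose coefficients are
    the components of [X] in [c], smooth by the definition of [vfield]. *)
Lemma msmooth_mdiff m (g : M -> 'rV[R]_m) (X : M -> 'rV[R]_n) :
  msmooth U g -> vfield U X -> msmooth U (fun q => mdiff g q (X q)).
Proof.
move=> sg vX c ac k.
have oA := @open_chart_image U c oU.
have sX : Ck k (cmap c @` (U `&` cdom c))
    ((fun q => mdiff (cmap c) q (X q)) \o cinv c).
  by apply: Ck_sub (vX c ac c ac k) => _ [q [Uq cq] <-]; exists q.
apply: (@Ck_eq _ _ _ k _ (fun y => \sum_i
    (mdiff (cmap c) (cinv c y) (X (cinv c y))) 0 i *:
    'D_(delta_mx 0 i) (g \o cinv c) y)) => //.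
  move=> _ [q [Uq cq] <-] /=.
  rewrite cmapK// -derive_sum_delta; last exact: msmooth_differentiable sg _ _ _.
  by rewrite -mdiff_chart//; exact: msmooth_differentiable sg _ _ _.
apply: Ck_sum => // i; apply: Ck_scale => //.
  exact: (Ck_coord i _ sX).
by have [_] := sg c ac k.+1; apply.
Qed.

Lemma vfield_sub (U' : set M) (X : M -> 'rV[R]_n) : U `<=` U' -> vfield U' X -> vfield U X.
Proof.
move=> UU vX c ac c' ac' k; apply: Ck_sub (vX c ac c' ac' k).
by move=> _ [q [[Uq cq] cq'] <-]; exists q => //; split=> //; split=> //; exact: UU.
Qed.

End Closure.

Section Pointwise.
Variable p : M.

Lemma mdiff_bilinear m l (W : normedModType R) (B : 'rV[R]_m -> 'rV[R]_l -> W) F G v :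
  bilinear_form B -> mdifferentiable p F -> mdifferentiable p G ->
  mdiff (fun q => B (F q) (G q)) p v = B (mdiff F p v) (G p) + B (F p) (mdiff G p v).
Proof.
move=> HB dF dG; have := (derive_bilinear HB v dF dG).2 => /=.
rewrite cmapK; last exact: mem_chart_at.
by [].
Qed.

Lemma mdifferentiable_bilinear m l (W : normedModType R)
    (B : 'rV[R]_m -> 'rV[R]_l -> W) F G :
  bilinear_form B -> mdifferentiable p F -> mdifferentiable p G ->
  mdifferentiable p (fun q => B (F q) (G q)).
Proof. by move=> HB dF dG; exact: (derive_bilinear HB 0 dF dG).1. Qed.

Lemma mdiff_lincomb m (F G H : M -> 'rV[R]_m) a v :
  mdifferentiable p F -> mdifferentiable p G -> mdifferentiable p H ->
  mdiff (fun q => F q + a *: G q - H q) p v =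
  mdiff F p v + a *: mdiff G p v - mdiff H p v.
Proof.
move=> dF dG dH; have dZ := derivableZ (k := a) (diff_derivable (v := v) dG).
rewrite -(deriveZ a (diff_derivable (v := v) dG)).
rewrite -(deriveD (diff_derivable (v := v) dF) dZ).
exact: (deriveB (derivableD (diff_derivable (v := v) dF) dZ) (diff_derivable dH)).
Qed.

Lemma mdiff_coord m (F : M -> 'rV[R]_m) v i : mdifferentiable p F ->
  mdiff (fun q => F q 0 i) p v = (mdiff F p v) 0 i.
Proof. by move=> dF; exact: (derive_coord i v dF). Qed.

Lemma mdiff_linear (V : normedModType R) (g : M -> V) a u v : mdifferentiable p g ->
  mdiff g p (a *: u + v) = a *: mdiff g p u + mdiff g p v.
Proof. by move=> dg; exact: derive_linear. Qed.

Lemma mdiff_subr (V : normedModType R) (g : M -> V) u v : mdifferentiable p g ->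
  mdiff g p (u - v) = mdiff g p u - mdiff g p v.
Proof. by move=> dg; rewrite addrC -scaleN1r mdiff_linear// scaleN1r addrC. Qed.

Lemma mdiff_sumr (V : normedModType R) (g : M -> V) (I : Type) (s : seq I)
    (h : I -> R) (F : I -> 'rV[R]_n) : mdifferentiable p g ->
  mdiff g p (\sum_(i <- s) h i *: F i) = \sum_(i <- s) h i *: mdiff g p (F i).
Proof.
move=> dg; elim: s => [|i s IH]; last by rewrite !big_cons mdiff_linear// IH.
by rewrite !big_nil -(subrr (0 : 'rV[R]_n)) mdiff_subr// subrr.
Qed.

Lemma mdiff_cst (V : normedModType R) (w : V) v : mdiff (cst w : M -> V) p v = 0.
Proof. exact: derive_cst. Qed.

Lemma mdiff_sum (I : Type) (s : seq I) (V : normedModType R) (F : I -> M -> V) v :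
  (forall i, mdifferentiable p (F i)) ->
  mdiff (fun q => \sum_(i <- s) F i q) p v = \sum_(i <- s) mdiff (F i) p v.
Proof. by move=> dF; exact: (derive_fsum s v dF).2. Qed.

End Pointwise.
End ManifoldCalculus.

(** * The cross product *)

Section LinearAlgebra.
Context {R : realType}.

Lemma bilinear_formP m n (W : normedModType R) (B : 'rV[R]_m -> 'rV[R]_n -> W) :
  (forall v a u u', B (a *: u + u') v = a *: B u v + B u' v) ->
  (forall u a v v', B u (a *: v + v') = a *: B u v + B u v') -> bilinear_form B.
Proof.
move=> Bl Br; exists (fun i j => B (delta_mx 0 i) (delta_mx 0 j)) => u v.
have B0l w : B 0 w = 0.
  (* With coefficient -1 and zero vectors, linearity reads B 0 w = - B 0 w + B 0 w. The same device
     recurs for the connections. *)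
  by have := Bl w (-1) 0 0; rewrite scaler0 addr0 scaleN1r addNr.
have B0r w : B w 0 = 0.
  by have := Br w (-1) 0 0; rewrite scaler0 addr0 scaleN1r addNr.
have Bsl (s : seq 'I_m) w :
    B (\sum_(i <- s) u 0 i *: delta_mx 0 i) w = \sum_(i <- s) u 0 i *: B (delta_mx 0 i) w.
  by elim: s => [|i s IH]; [rewrite !big_nil B0l|rewrite !big_cons Bl IH].
have Bsr (s : seq 'I_n) w :
    B w (\sum_(i <- s) v 0 i *: delta_mx 0 i) = \sum_(i <- s) v 0 i *: B w (delta_mx 0 i).
  by elim: s => [|i s IH]; [rewrite !big_nil B0r|rewrite !big_cons Br IH].
rewrite {1}(rowE_delta u) {1}(rowE_delta v) Bsl.
rewrite -(pair_bigA _ (fun i j => (u 0 i * v 0 j) *: B (delta_mx 0 i) (delta_mx 0 j))) /=.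
apply: eq_bigr => i _; rewrite Bsr scaler_sumr.
by apply: eq_bigr => j _; rewrite scalerA.
Qed.

(* The uniqueness of a torsion-free metric connection, in components. *)
Lemma sym_antisym_eq0 (I : Type) (c : I -> I -> I -> R) :
  (forall i j k, c i j k = c j i k) -> (forall i j k, c i j k = - c i k j) ->
  forall i j k, c i j k = 0.
Proof.
move=> s a i j k; have : c i j k = - c i j k.
  (* The symmetry followed by the antisymmetry is a 3-cycle of the indices with sign -1; its cube is
     the identity with sign -1. *)
  by rewrite {1}s {1}a {1}s {1}a {1}s {1}a !opprK.
by move/eqP; rewrite -addr_eq0 -mulr2n mulrn_eq0 /= => /eqP.
Qed.

Section Dot.
Context {n : nat}.
Implicit Types u v w : 'rV[R]_n.

Lemma dotE u v : dot u v = \sum_i u 0 i * v 0 i.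
Proof. by []. Qed.

Lemma dotC u v : dot u v = dot v u.
Proof. by apply: eq_bigr => i _; rewrite mulrC. Qed.

Lemma dotDl u v w : dot (u + v) w = dot u w + dot v w.
Proof. by rewrite -big_split; apply: eq_bigr => i _; rewrite mxE mulrDl. Qed.

Lemma dotDr u v w : dot w (u + v) = dot w u + dot w v.
Proof. by rewrite dotC dotDl !(dotC w). Qed.

Lemma dotZl a u v : dot (a *: u) v = a * dot u v.
Proof. by rewrite mulr_sumr; apply: eq_bigr => i _; rewrite mxE mulrA. Qed.

Lemma dotZr a u v : dot u (a *: v) = a * dot u v.
Proof. by rewrite dotC dotZl dotC. Qed.

Lemma dotNl u v : dot (- u) v = - dot u v.
Proof. by rewrite -scaleN1r dotZl mulN1r. Qed.

Lemma dotNr u v : dot u (- v) = - dot u v.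
Proof. by rewrite dotC dotNl dotC. Qed.

Lemma dot0l u : dot 0 u = 0.
Proof. by rewrite -(scale0r (0 : 'rV[R]_n)) dotZl mul0r. Qed.

Lemma dot0r u : dot u 0 = 0.
Proof. by rewrite dotC dot0l. Qed.

Lemma dot_suml (I : Type) (s : seq I) (F : I -> 'rV[R]_n) v :
  dot (\sum_(i <- s) F i) v = \sum_(i <- s) dot (F i) v.
Proof. by elim: s => [|i s IH]; rewrite ?big_nil ?dot0l// !big_cons dotDl IH. Qed.

Lemma dot_sumr (I : Type) (s : seq I) (F : I -> 'rV[R]_n) v :
  dot v (\sum_(i <- s) F i) = \sum_(i <- s) dot v (F i).
Proof. by rewrite dotC dot_suml; apply: eq_bigr => i _; rewrite dotC. Qed.

Lemma dot_delta u i : dot u (delta_mx 0 i) = u 0 i.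
Proof.
rewrite /dot (bigD1 i)//= big1 => [|j ji]; rewrite mxE eqxx ?(negbTE ji) ?mulr0//.
by rewrite eqxx mulr1 addr0.
Qed.

Lemma bilinear_dot : @bilinear_form R n n R (@dot R n).
Proof. by apply: bilinear_formP => *; rewrite ?dotDl ?dotZl ?dotDr ?dotZr. Qed.

End Dot.

Implicit Types u v w x : 'rV[R]_7.

(** The octonion product is unfolded only here; in coordinates the basic identities of the cross
    product become polynomial identities, decided by [ring]. *)
Lemma crossE u v : cross u v = \row_(i < 7) nth 0
  [:: coef7 u 1 * coef7 v 2 - coef7 u 2 * coef7 v 1 + coef7 u 3 * coef7 v 4
      - coef7 u 4 * coef7 v 3 + coef7 u 6 * coef7 v 5 - coef7 u 5 * coef7 v 6;
      coef7 u 2 * coef7 v 0 - coef7 u 0 * coef7 v 2 + coef7 u 3 * coef7 v 5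
      - coef7 u 5 * coef7 v 3 + coef7 u 4 * coef7 v 6 - coef7 u 6 * coef7 v 4;
      coef7 u 0 * coef7 v 1 - coef7 u 1 * coef7 v 0 + coef7 u 5 * coef7 v 4
      - coef7 u 4 * coef7 v 5 + coef7 u 3 * coef7 v 6 - coef7 u 6 * coef7 v 3;
      coef7 u 4 * coef7 v 0 - coef7 u 0 * coef7 v 4 + coef7 u 5 * coef7 v 1
      - coef7 u 1 * coef7 v 5 + coef7 u 6 * coef7 v 2 - coef7 u 2 * coef7 v 6;
      coef7 u 0 * coef7 v 3 - coef7 u 3 * coef7 v 0 + coef7 u 6 * coef7 v 1
      - coef7 u 1 * coef7 v 6 + coef7 u 2 * coef7 v 5 - coef7 u 5 * coef7 v 2;
      coef7 u 1 * coef7 v 3 - coef7 u 3 * coef7 v 1 + coef7 u 4 * coef7 v 2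
      - coef7 u 2 * coef7 v 4 + coef7 u 0 * coef7 v 6 - coef7 u 6 * coef7 v 0;
      coef7 u 1 * coef7 v 4 - coef7 u 4 * coef7 v 1 + coef7 u 2 * coef7 v 3
      - coef7 u 3 * coef7 v 2 + coef7 u 5 * coef7 v 0 - coef7 u 0 * coef7 v 5] i.
Proof.
rewrite /cross /cayley_mul /quat_mul /cplx_mul /quat_conj /cplx_conj /cd_mul /cd_conj /=.
apply/rowP; case=> -[|[|[|[|[|[|[|//]]]]]]] ? /=; rewrite !mxE /=; by field.
Qed.

Lemma coef7D u v k : coef7 (u + v) k = coef7 u k + coef7 v k.
Proof. by rewrite /coef7 mxE. Qed.

Lemma coef7Z a u k : coef7 (a *: u) k = a * coef7 u k.
Proof. by rewrite /coef7 mxE. Qed.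

Lemma dot7E u v : dot u v = coef7 u 0 * coef7 v 0 + coef7 u 1 * coef7 v 1
  + coef7 u 2 * coef7 v 2 + coef7 u 3 * coef7 v 3 + coef7 u 4 * coef7 v 4
  + coef7 u 5 * coef7 v 5 + coef7 u 6 * coef7 v 6.
Proof.
have -> : dot u v = \sum_(i < 7) coef7 u i * coef7 v i.
  by apply: eq_bigr => i _; rewrite /coef7 inord_val.
by rewrite !big_ord_recr big_ord0 /= add0r.
Qed.

Lemma cross_linearl v a u u' : cross (a *: u + u') v = a *: cross u v + cross u' v.
Proof.
rewrite !crossE !coef7D !coef7Z.
by apply/rowP; case=> -[|[|[|[|[|[|[|//]]]]]]] ? /=; rewrite !mxE /=; ring.
Qed.

Lemma crossC u v : cross u v = - cross v u.
Proof.
rewrite !crossE.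
by apply/rowP; case=> -[|[|[|[|[|[|[|//]]]]]]] ? /=; rewrite !mxE /=; ring.
Qed.

Lemma crossDl u v w : cross (u + v) w = cross u w + cross v w.
Proof. by rewrite -[u]scale1r cross_linearl !scale1r. Qed.

Lemma cross0l w : cross 0 w = 0.
Proof. by have := cross_linearl w (-1) 0 0; rewrite scaler0 addr0 scaleN1r addNr. Qed.

Lemma crossZl a u w : cross (a *: u) w = a *: cross u w.
Proof. by rewrite -[a *: u]addr0 cross_linearl cross0l addr0. Qed.

Lemma crossDr u v w : cross w (u + v) = cross w u + cross w v.
Proof. by rewrite crossC crossDl opprD -!(crossC w). Qed.

Lemma crossZr a u w : cross w (a *: u) = a *: cross w u.
Proof. by rewrite crossC crossZl -scalerN -crossC. Qed.

Lemma crossxx u : cross u u = 0.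
Proof.
have /eqP := crossC u u; rewrite -addr_eq0 -mulr2n -scaler_nat scaler_eq0.
by rewrite pnatr_eq0 => /eqP.
Qed.

Lemma cross_suml (I : Type) (s : seq I) (F : I -> 'rV[R]_7) v :
  cross (\sum_(i <- s) F i) v = \sum_(i <- s) cross (F i) v.
Proof. by elim: s => [|i s IH]; rewrite ?big_nil ?cross0l// !big_cons crossDl IH. Qed.

Lemma cross_sumr (I : Type) (s : seq I) (F : I -> 'rV[R]_7) v :
  cross v (\sum_(i <- s) F i) = \sum_(i <- s) cross v (F i).
Proof. by rewrite crossC cross_suml -sumrN; apply: eq_bigr => i _; rewrite -crossC. Qed.

Lemma bilinear_cross : bilinear_form (@cross R).
Proof. by apply: bilinear_formP => *; rewrite ?crossDl ?crossZl ?crossDr ?crossZr. Qed.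

Lemma coef7_row (s : seq R) k : (k < 7)%N ->
  coef7 (\row_(i < 7) nth 0 s i) k = nth 0 s k.
Proof. by move=> k7; rewrite /coef7 mxE inordK. Qed.

(** Together with [crossC] this makes the triple product the alternating 3-form associated with the
    octonions. *)
Lemma dot_cross_rot u v w : dot (cross u v) w = dot (cross v w) u.
Proof. by rewrite !crossE !dot7E !coef7_row//=; ring. Qed.

Lemma dot_crossC u v w : dot (cross u v) w = - dot (cross v u) w.
Proof. by rewrite crossC dotNl. Qed.

Lemma dot_cross_skew x u v : dot (cross x u) v = - dot u (cross x v).
Proof. by rewrite (dotC u) -dot_crossC -dot_cross_rot -dot_cross_rot. Qed.

Lemma dot_crossl x u : dot x (cross x u) = 0.
Proof. by rewrite dotC dot_cross_rot dot_cross_rot crossxx dot0l. Qed.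

(** For a unit vector [u] it says that [cross u] is isometric on the orthogonal complement of [u],
    that is, J is orthogonal. *)
Lemma dot_cross_cross u v w :
  dot (cross u v) (cross u w) = dot u u * dot v w - dot u v * dot u w.
Proof. by rewrite !crossE !dot7E !coef7_row//=; ring. Qed.

(** The identity [E] is [dot_cross_cross] polarized in its repeated vector. With [x] the position
    vector, the conclusion becomes the antisymmetry of omega in its last two arguments. *)
Lemma dot_cross_polar x u v w : dot u x = 0 -> dot v x = 0 -> dot w x = 0 ->
  dot (cross u v) (cross x w) = - dot (cross u w) (cross x v).
Proof.
move=> ux vx wx.
have E : dot (cross u v) (cross x w) + dot (cross u w) (cross x v) =
    2 * (dot u x * dot v w) - dot v x * dot u w - dot w x * dot u v.
  by rewrite !crossE !dot7E !coef7_row//=; ring.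
by apply/eqP; rewrite -addr_eq0 E ux vx wx !mul0r mulr0 !subr0.
Qed.

End LinearAlgebra.

(** * The round sphere *)

Section SphereConnection.
Context {R : realType}.
Implicit Types (x y u v w : 'rV[R]_7) (A : set 'rV[R]_7) (X Y : 'rV[R]_7 -> 'rV[R]_7).

Definition tproj x u : 'rV[R]_7 := u - dot x u *: x.

Lemma tproj_linear x a u v : tproj x (a *: u + v) = a *: tproj x u + tproj x v.
Proof.
rewrite /tproj dotDr dotZr scalerDl scalerBr scalerA opprD addrACA.
by rewrite -scalerA.
Qed.

Lemma tproj0 x : tproj x 0 = 0.
Proof. by rewrite /tproj dot0r scale0r subrr. Qed.

Lemma tproj_sum x (I : Type) (s : seq I) (F : I -> 'rV[R]_7) (h : I -> R) :
  tproj x (\sum_(i <- s) h i *: F i) = \sum_(i <- s) h i *: tproj x (F i).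
Proof.
by elim: s => [|i s IH]; rewrite ?big_nil ?tproj0// !big_cons tproj_linear IH.
Qed.

Lemma dot_tproj x u : S6 x -> dot x (tproj x u) = 0.
Proof. by move=> x1; rewrite /tproj dotDr dotNr dotZr x1 mulr1 subrr. Qed.

Lemma tproj_id x u : dot x u = 0 -> tproj x u = u.
Proof. by move=> xu; rewrite /tproj xu scale0r subr0. Qed.

(* The gradient on the sphere of the [i]-th coordinate. *)
Definition coord_grad (i : 'I_7) y : 'rV[R]_7 := tproj y (delta_mx 0 i).

Lemma coord_gradE i y : coord_grad i y = delta_mx 0 i - y 0 i *: y.
Proof. by rewrite /coord_grad /tproj dot_delta. Qed.

(** A tangent vector is the combination of the coordinate gradients whose coefficients are its own
    coordinates in R^7. This replaces a local frame of the sphere. *)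
Lemma sum_coord_grad x u : \sum_i u 0 i *: coord_grad i x = tproj x u.
Proof. by rewrite {2}(rowE_delta u) tproj_sum. Qed.

Let bilinear_coord i : bilinear_form (fun u v : 'rV[R]_7 => u 0 i *: v).
Proof.
apply: bilinear_formP => [v a u u'|u a v v']; first by rewrite !mxE scalerDl scalerA.
by rewrite scalerDr !scalerA mulrC.
Qed.

Lemma smooth_coord_grad i A : open A -> smooth A (coord_grad i).
Proof.
move=> oA k; apply: (@Ck_eq _ _ _ _ _ (fun y => delta_mx 0 i + - (y 0 i *: y))) => //.
  by move=> y _; rewrite coord_gradE.
apply: CkD => //; first exact: Ck_cst.
apply: CkN => //; apply: (Ck_bilinear (bilinear_coord i) oA); exact: Ck_id.
Qed.

Lemma sphere_vfield_coord_grad i A : open A -> sphere_vfield A (coord_grad i).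
Proof.
by move=> oA; split=> [|y _ y1]; [exact: smooth_coord_grad|exact: dot_tproj].
Qed.

Lemma sphere_vfield_at_coord_grad i x : sphere_vfield_at x (coord_grad i).
Proof. by exists setT; split=> //; [exact: openT|apply: sphere_vfield_coord_grad; exact: openT]. Qed.

Lemma derive_coord_grad i x v :
  'D_v (coord_grad i) x = - (v 0 i *: x + x 0 i *: v).
Proof.
have did : differentiable (id : 'rV[R]_7 -> 'rV[R]_7) x by exact: ex_diff.
have [dB eB] := derive_bilinear (bilinear_coord i) v did did.
rewrite (_ : coord_grad i = cst (delta_mx 0 i) - (fun y => y 0 i *: y)); last first.
  by apply/funext => y; rewrite coord_gradE.
rewrite deriveB; [|exact: derivable_cst|exact: diff_derivable].
by rewrite derive_cst sub0r eB derive_id.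
Qed.

Lemma sphere_vfield_at_differentiable x Y : sphere_vfield_at x Y -> differentiable Y x.
Proof. by move=> [A [_ Ax [sY _]]]; exact: smooth_differentiable sY Ax. Qed.

Variable D : 'rV[R]_7 -> 'rV[R]_7 -> ('rV[R]_7 -> 'rV[R]_7) -> 'rV[R]_7.
Hypothesis D_lc : sphere_levi_civita D.

(** Torsion-freeness is stated on functions; it is tested on the coordinate functions, whose
    derivatives along a field are the components of that field. *)
Lemma slc_bracket x X Y : S6 x -> sphere_vfield_at x X -> sphere_vfield_at x Y ->
  D x (X x) Y - D x (Y x) X = 'D_(X x) Y x - 'D_(Y x) X x.
Proof.
move=> x1 vX vY; apply/rowP => i.
have dcoord w z : 'D_w (fun y : 'rV[R]_7 => y 0 i) z = w 0 i.
  by rewrite (@derive_coord _ _ _ id) ?derive_id//; exact: ex_diff.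
have := @slc_torsion_free _ _ D_lc x setT X Y (fun y => y 0 i) x1 vX vY openT I.
rewrite dcoord => ->.
  rewrite !mxE; congr (_ - _).
    rewrite -derive_coord; last exact: sphere_vfield_at_differentiable.
    by congr ('D_ _ _ _); apply/funext => y; rewrite dcoord.
  rewrite -derive_coord; last exact: sphere_vfield_at_differentiable.
  by congr ('D_ _ _ _); apply/funext => y; rewrite dcoord.
by move=> k; apply: (@Ck_coord _ _ _ k setT id); [exact: openT|exact: Ck_id].
Qed.

Lemma slc_sum (I : Type) (s : seq I) (h : I -> R) (F : I -> 'rV[R]_7) x Y :
  S6 x -> sphere_vfield_at x Y -> (forall i, dot x (F i) = 0) ->
  D x (\sum_(i <- s) h i *: F i) Y = \sum_(i <- s) h i *: D x (F i) Y.
Proof.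
move=> x1 vY xF; elim: s => [|i s IH].
  have := slc_linear D_lc (-1) x1 (dot0r x) (dot0r x) vY.
  by rewrite !big_nil scaler0 addr0 scaleN1r addNr.
rewrite !big_cons (slc_linear D_lc)// ?IH// dot_sumr big1// => j _.
by rewrite dotZr xF mulr0.
Qed.

(** The Hessian of a linear function on the unit sphere is minus that function times the metric.
    Since [D] is only given by axioms, this comes from the uniqueness of the Levi-Civita connection,
    tested on the coordinate gradients. *)
Lemma slc_coord_grad x i v : S6 x -> dot x v = 0 -> D x v (coord_grad i) = - (x 0 i *: v).
Proof.
move=> x1 xv; have vE := sphere_vfield_at_coord_grad^~ x.
have xE k : dot x (coord_grad k x) = 0 by exact: dot_tproj.
(* [C] is the error of the claimed formula. Torsion-freeness makes its components symmetric in [k],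
   [l], and metricity makes them skew in [l], [j]. *)
pose C k l := D x (coord_grad k x) (coord_grad l) + x 0 l *: coord_grad k x.
have C0 : forall k l j, dot (C k l) (coord_grad j x) = 0.
  apply: sym_antisym_eq0 => [k l j|k l j].
    congr dot; apply/eqP; rewrite -subr_eq0 /C opprD addrACA slc_bracket// !derive_coord_grad.
    have -> : (coord_grad k x) 0 l = (coord_grad l x) 0 k.
      by rewrite !coord_gradE !mxE !eqxx /= (eq_sym k l) mulrC.
    by apply/eqP/rowP => m; rewrite !mxE; ring.
  apply/eqP; rewrite -addr_eq0; apply/eqP; rewrite /C.
  have := slc_metric D_lc x1 (xE k) (vE l) (vE j).
  have [_ ->] := derive_bilinear (@bilinear_dot R 7) (coord_grad k x)
    (sphere_vfield_at_differentiable (vE l)) (sphere_vfield_at_differentiable (vE j)).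
  rewrite !derive_coord_grad; move: (xE j) (xE l).
  move: (D x _ (coord_grad l)) (D x _ (coord_grad j)).
  move: (coord_grad k x) (coord_grad l x) (coord_grad j x) => a b c d e xc xb.
  rewrite !(dotNl, dotNr, dotDl, dotDr, dotZl, dotZr) xc (dotC b x) xb (dotC b a) (dotC b e).
  by move=> E; rewrite addrACA -E; ring.
have {}C0 k l : C k l = 0.
  apply/rowP => j; rewrite [RHS]mxE -[LHS]dot_delta.
  (* The tangential components of [C k l] vanish by the above, and the radial one because both of
     its terms are tangent. *)
  have -> : delta_mx 0 j = coord_grad j x + x 0 j *: x by rewrite coord_gradE subrK.
  rewrite dotDr C0 add0r dotZr dotC [C _ _]/C dotDr dotZr xE mulr0 addr0.
  by rewrite (slc_tangent D_lc)// mulr0.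
rewrite -{1 2}(tproj_id xv) -sum_coord_grad slc_sum// scaler_sumr -sumrN.
apply: eq_bigr => k _; rewrite scalerA mulrC -scalerA -scalerN; congr (_ *: _).
by apply/eqP; rewrite -addr_eq0; apply/eqP; exact: C0.
Qed.

(** On the sphere [Y] agrees with its expansion in coordinate gradients, and [slc_restrict] allows
    the replacement. After Leibniz' rule the derivatives of the gradients contribute a multiple of
    [dot x (Y x)], which is zero. *)
Lemma slcE x v Y : S6 x -> dot x v = 0 -> sphere_vfield_at x Y ->
  D x v Y = tproj x ('D_v Y x).
Proof.
move=> x1 xv vY; have [A [oA Ax [sY tY]]] := vY.
have vh (i : 'I_7) : sphere_vfield A (fun y => Y y 0 i *: coord_grad i y).
  split=> [k|y _ y1]; last by rewrite dotZr dot_tproj// mulr0.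
  by apply: Ck_scale => //; [exact: Ck_coord|exact: smooth_coord_grad].
have vS (s : seq 'I_7) : sphere_vfield A (fun y => \sum_(i <- s) Y y 0 i *: coord_grad i y).
  split=> [k|y Ay y1]; first by apply: Ck_sum => // i; exact: (vh i).1.
  by rewrite dot_sumr big1// => i _; exact: (vh i).2.
rewrite (slc_restrict D_lc x1 xv oA Ax (conj sY tY) (vS (index_enum 'I_7))); last first.
  by move=> y Ay y1; rewrite sum_coord_grad tproj_id// tY.
have -> (s : seq 'I_7) : D x v (fun y => \sum_(i <- s) Y y 0 i *: coord_grad i y) =
    \sum_(i <- s) ('D_v (fun y => Y y 0 i) x *: coord_grad i x +
                   Y x 0 i *: D x v (coord_grad i)).
  elim: s => [|i s IH].
    have := slc_add D_lc x1 xv (ex_intro _ A (And3 oA Ax (vS [::])))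
                               (ex_intro _ A (And3 oA Ax (vS [::]))).
    rewrite (_ : (fun y => _ + _) = fun y => \sum_(i <- [::]) Y y 0 i *: coord_grad i y).
      by move/eqP; rewrite -subr_eq subrr big_nil eq_sym => /eqP.
    by apply/funext => y; rewrite !big_nil addr0.
  rewrite big_cons -IH.
  rewrite -(slc_leibniz D_lc x1 xv oA Ax _ (sphere_vfield_at_coord_grad i x)); last first.
    by move=> k; exact: Ck_coord.
  rewrite -(slc_add D_lc x1 xv).
  - by congr (D x v _); apply/funext => y; rewrite big_cons.
  - by exists A; split=> //; exact: vh.
  - by exists A; split=> //; exact: vS.
rewrite big_split /= [X in _ + X](_ : _ = 0) ?addr0.
  rewrite -sum_coord_grad; apply: eq_bigr => i _.
  by rewrite derive_coord//; exact: sphere_vfield_at_differentiable.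
transitivity (- (dot x (Y x) *: v)); last by rewrite tY// scale0r oppr0.
rewrite /dot scaler_suml -sumrN; apply: eq_bigr => i _.
by rewrite slc_coord_grad// scalerN scalerA mulrC.
Qed.

(** The flat product rule for y x Y(y) gives u x w plus x times the derivative of [Y]; the second
    term cancels against J (D_u Y), since the radial part removed by the projection is killed by
    [cross x]. *)
Lemma nkGE x u w : S6 x -> dot x u = 0 -> dot x w = 0 ->
  nkG D x u w = tproj x (cross u w).
Proof.
move=> x1 xu xw.
have GE Y : sphere_vfield_at x Y -> Y x = w ->
    D x u (fun y => cross y (Y y)) - cross x (D x u Y) = tproj x (cross u w).
  move=> vY Yx; have dY := sphere_vfield_at_differentiable vY.
  have vJ : sphere_vfield_at x (fun y => cross y (Y y)).
    have [A [oA Ax [sY tY]]] := vY; exists A; split=> //; split=> [k|y _ _].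
      exact: (Ck_bilinear bilinear_cross oA (Ck_id _ _) (sY k)).
    by rewrite dot_crossl.
  have did : differentiable (id : 'rV[R]_7 -> 'rV[R]_7) x by exact: ex_diff.
  rewrite !slcE// (derive_bilinear bilinear_cross u did dY).2 derive_id Yx.
  rewrite -[X in tproj x (X + _)]scale1r tproj_linear scale1r -addrA.
  rewrite [X in _ + X](_ : _ = 0) ?addr0// [X in X - _]tproj_id.
    by rewrite /tproj crossDr -scaleNr crossZr crossxx scaler0 addr0 subrr.
  by rewrite dot_crossl.
rewrite /nkG; have [E|nE] := pselect (exists Y, sphere_vfield_at x Y /\ Y x = w); last first.
  (* If no field took the value [w] at [x], every vector would satisfy the defining condition of
     [nkG] vacuously. The combination of coordinate gradients with constant coefficients [w] is such
     a field. *)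
  exfalso; apply: nE; exists (fun y => \sum_i w 0 i *: coord_grad i y).
  rewrite sum_coord_grad tproj_id//; split=> //; exists setT; split=> //; first exact: openT.
  split=> [k|y _ y1]; last by rewrite sum_coord_grad dot_tproj.
  apply: Ck_sum => [|i]; first exact: openT.
  by apply: Ck_scale; [exact: openT|exact: Ck_cst|apply: smooth_coord_grad; exact: openT].
have [Y [vY Yx]] := E.
have := @getPex _ [set z | forall Y, sphere_vfield_at x Y -> Y x = w ->
    z = D x u (fun y => cross y (Y y)) - cross x (D x u Y)].
move=> /= H; rewrite (H _ Y vY Yx) ?GE//.
by exists (tproj x (cross u w)) => Z vZ Zx; rewrite GE.
Qed.

End SphereConnection.

(** * Submanifolds of the sphere *)

(* Otherwise unification, on a failed match, unfolds these down to limits and to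
   the octonion product and does not terminate in practice. *)
#[local] Opaque mdiff derive cross dot.

Section Immersion.
Context {R : realType} {M : smoothManifold (R := R) 3}.
Implicit Types (p q : M) (X Y Z : M -> 'rV[R]_3) (V : M -> 'rV[R]_7) (U : set M).

Variables (f : M -> 'rV[R]_7).
Hypothesis f_imm : sphere_immersion f.

Let f_smooth : msmooth setT f. Proof. by have [] := f_imm. Qed.
Let f_S6 p : S6 (f p). Proof. by have [_ h _] := f_imm. Qed.

Lemma immersion_differentiable p : mdifferentiable p f.
Proof. by apply: msmooth_at_differentiable; exists setT; split=> //; exact: openT. Qed.

Let df p := immersion_differentiable p.

Lemma dot_immersion_mdiff p v : dot (f p) (mdiff f p v) = 0.
Proof.
have := mdiff_bilinear v (@bilinear_dot R 7) (df p) (df p).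
rewrite (_ : (fun q => dot (f q) (f q)) = cst 1); last first.
  by apply/funext => q; exact: f_S6.
by rewrite mdiff_cst dotC -mulr2n => /esym/eqP; rewrite mulrn_eq0 /= => /eqP.
Qed.

Lemma along_at_differentiable p V : along_at f p V -> mdifferentiable p V.
Proof.
by move=> [U [oU Up [sV _]]]; apply: msmooth_at_differentiable; exists U.
Qed.

Lemma dot_immersion_along p v V : along_at f p V ->
  dot (f p) (mdiff V p v) = - dot (mdiff f p v) (V p).
Proof.
move=> aV; have dV := along_at_differentiable aV; have [U [oU Up [_ tV]]] := aV.
have := mdiff_bilinear v (@bilinear_dot R 7) (df p) dV.
rewrite (@mdiff_near_eq _ _ _ _ _ (cst 0)) ?mdiff_cst; last first.
  by apply: filterS (open_nbhs_nbhs (conj oU Up)) => q /tV.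
by move/eqP; rewrite eq_sym addrC addr_eq0 => /eqP.
Qed.

Lemma tproj_mdiff p v V : along_at f p V ->
  tproj (f p) (mdiff V p v) = mdiff V p v + dot (mdiff f p v) (V p) *: f p.
Proof. by move=> aV; rewrite /tproj dot_immersion_along// scaleNr opprK. Qed.

Lemma along_push U X : open U -> vfield U X -> along f U (push f X).
Proof.
move=> oU vX; split=> [|p _]; last exact: dot_immersion_mdiff.
by apply: msmooth_mdiff => //; exact: msmooth_sub f_smooth.
Qed.

Lemma along_at_push p X : vfield_at p X -> along_at f p (push f X).
Proof. by move=> [U [oU Up vX]]; exists U; split=> //; exact: along_push. Qed.

Lemma along_coord_grad U i : open U -> along f U (coord_grad i \o f).
Proof.
move=> oU; split=> [|p _]; last exact: dot_tproj.
have sf : msmooth U f by exact: msmooth_sub f_smooth.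
apply: (@msmooth_eq _ _ _ _ _ _ (fun q => delta_mx 0 i + - (f q 0 i *: f q))) => //.
  by move=> q _; rewrite /= coord_gradE.
apply: msmoothD => //; first exact: msmooth_cst.
by apply: msmoothN => //; apply: msmooth_scale => //; exact: msmooth_coord.
Qed.

(** * The pullback connection, the second fundamental form and the cubic form *)

Section Connection.
Variable D : 'rV[R]_7 -> 'rV[R]_7 -> ('rV[R]_7 -> 'rV[R]_7) -> 'rV[R]_7.
Hypothesis D_lc : sphere_levi_civita D.
Variable Dbar : M -> 'rV[R]_3 -> (M -> 'rV[R]_7) -> 'rV[R]_7.
Hypothesis Dbar_pc : pullback_connection f D Dbar.

(* Leibniz' rule for the indicator function of [U], which is smooth at [p]. *)
Lemma pc_local p v U V V' : open U -> U p -> along f U V -> (forall q, U q -> V q = V' q) ->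
  Dbar p v V = Dbar p v V'.
Proof.
move=> oU Up aV VV.
have aV' : along f U V'.
  split=> [|q Uq]; last by rewrite -VV// aV.2.
  by apply: msmooth_eq aV.1.
pose h : M -> R := fun q => (`[< U q >])%:R.
have hE q : U q -> h q = 1 by move=> Uq; rewrite /h asboolT.
have hs : msmooth_at p h.
  exists U; split=> //; apply: (@msmooth_eq _ _ _ _ oU R (@cst M R 1)) => [q /hE //|].
  exact: msmooth_cst.
have e1 := pc_leibniz Dbar_pc v hs (ex_intro _ U (And3 oU Up aV)).
have e2 := pc_leibniz Dbar_pc v hs (ex_intro _ U (And3 oU Up aV')).
have E : (fun q => h q *: V q) = (fun q => h q *: V' q).
  apply/funext => q; rewrite /h; case: asboolP => [/VV ->//|_]; by rewrite !scale0r.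
move: e1; rewrite E e2 VV// hE// !scale1r.
by move/addrI => ->.
Qed.

(** A field along [f] need not be the restriction of a field on the sphere, so the pullback axiom
    does not apply to [V] itself. It applies to the fields [coord_grad i \o f], in which [V] is
    expanded near [p]. *)
Lemma pcE p v V : along_at f p V -> Dbar p v V = tproj (f p) (mdiff V p v).
Proof.
move=> aV; have dV := along_at_differentiable aV.
have [U [oU Up [sV tV]]] := aV.
have ah (i : 'I_7) : along f U (fun q => V q 0 i *: coord_grad i (f q)).
  split=> [|q _]; last by rewrite dotZr dot_tproj// mulr0.
  apply: msmooth_scale => //; first exact: msmooth_coord.
  exact: (along_coord_grad i oU).1.
have aS (s : seq 'I_7) : along f U (fun q => \sum_(i <- s) V q 0 i *: coord_grad i (f q)).
  elim: s => [|i s [IH1 IH2]].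
    split=> [|q _]; last by rewrite big_nil dot0r.
    apply: (@msmooth_eq _ _ _ _ _ _ (cst 0)) => //; last exact: msmooth_cst.
    by move=> q _; rewrite big_nil.
  split=> [|q Uq]; last by rewrite big_cons dotDr IH2// (ah i).2// addr0.
  apply: (@msmooth_eq _ _ _ _ _ _ (fun q => V q 0 i *: coord_grad i (f q) +
    \sum_(i <- s) V q 0 i *: coord_grad i (f q))) => //.
    by move=> q _; rewrite big_cons.
  by apply: msmoothD => //; exact: (ah i).1.
rewrite (@pc_local p v U V (fun q => \sum_i V q 0 i *: coord_grad i (f q)))//; last first.
  by move=> q Uq; rewrite sum_coord_grad tproj_id// tV.
have -> (s : seq 'I_7) : Dbar p v (fun q => \sum_(i <- s) V q 0 i *: coord_grad i (f q)) =
    \sum_(i <- s) (mdiff (fun q => V q 0 i) p v *: coord_grad i (f p) +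
                   V p 0 i *: Dbar p v (coord_grad i \o f)).
  elim: s => [|i s IH].
    have aa : along_at f p (fun q => \sum_(i <- [::]) V q 0 i *: coord_grad i (f q)).
      by exists U; split=> //; exact: aS.
    have := pc_add Dbar_pc v aa aa.
    rewrite (_ : (fun q => _ + _) = fun q => \sum_(i <- [::]) V q 0 i *: coord_grad i (f q)).
      by move/eqP; rewrite -subr_eq subrr big_nil eq_sym => /eqP.
    by apply/funext => q; rewrite !big_nil addr0.
  rewrite big_cons -IH -(pc_leibniz Dbar_pc); first last.
  - by exists U; split=> //; exact: along_coord_grad.
  - by exists U; split=> //; exact: msmooth_coord.
  rewrite -(pc_add Dbar_pc).
  - by congr (Dbar p v _); apply/funext => q; rewrite big_cons.
  - by exists U; split=> //; exact: ah.
  - by exists U; split=> //; exact: aS.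
rewrite big_split /= [X in _ + X](_ : _ = 0) ?addr0.
  by rewrite -sum_coord_grad; apply: eq_bigr => i _; rewrite mdiff_coord.
transitivity (- (dot (f p) (V p) *: mdiff f p v)); last by rewrite tV// scale0r oppr0.
rewrite dotE scaler_suml -sumrN; apply: eq_bigr => i _.
rewrite (pc_pullback Dbar_pc); last exact: sphere_vfield_at_coord_grad.
by rewrite (slc_coord_grad D_lc) ?dot_immersion_mdiff// scalerN scalerA mulrC.
Qed.

Variable nabla : forall p : M, 'rV[R]_3 -> (M -> 'rV[R]_3) -> 'rV[R]_3.
Hypothesis nabla_lc : levi_civita (induced_metric f) nabla.

Local Notation sff := (sff f Dbar nabla).
Local Notation cubic := (cubic f Dbar nabla).

(** Torsion-freeness, taken componentwise. With [V] the immersion it yields the symmetry of [sff];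
    with [V] a pushed-forward field it says that flat second derivatives commute. *)
Lemma lc_bracket p X Y V : vfield_at p X -> vfield_at p Y -> msmooth_at p V ->
  mdiff V p (nabla p (X p) Y - nabla p (Y p) X) =
  mdiff (fun q => mdiff V q (Y q)) p (X p) - mdiff (fun q => mdiff V q (X q)) p (Y p).
Proof.
move=> vX vY [A [oA Ap sA]].
have dV q : A q -> mdifferentiable q V.
  by move=> Aq; apply: msmooth_at_differentiable; exists A.
have dQ Z : vfield_at p Z -> mdifferentiable p (fun q => mdiff V q (Z q)).
  move=> [B [oB Bp vB]]; apply: msmooth_at_differentiable; exists (A `&` B).
  split=> //; first exact: openI.
  apply: msmooth_mdiff; first exact: openI.
    exact: (msmooth_sub (@subIsetl _ A B) sA).
  exact: (vfield_sub (@subIsetr _ A B) vB).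
apply/rowP => i.
have sVi : msmooth_at p (fun q => V q 0 i) by exists A; split=> //; exact: msmooth_coord.
have e Z v : vfield_at p Z -> mdiff (fun q => mdiff (fun q' => V q' 0 i) q (Z q)) p v =
    mdiff (fun q => mdiff V q (Z q)) p v 0 i.
  move=> vZ; apply: etrans (mdiff_coord v i (dQ Z vZ)).
  apply: mdiff_near_eq; apply: filterS (open_nbhs_nbhs (conj oA Ap)) => q Aq.
  exact: (mdiff_coord (Z q) i (dV q Aq)).
rewrite -(mdiff_coord _ i (dV p Ap)) (lc_torsion_free nabla_lc vX vY sVi).
have -> (a b : 'rV[R]_7) : (a - b) 0 i = a 0 i - b 0 i by rewrite !mxE.
by congr (_ - _); exact: e.
Qed.

Lemma push_bracket p X Y : vfield_at p X -> vfield_at p Y ->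
  mdiff f p (nabla p (X p) Y - nabla p (Y p) X) =
  mdiff (push f Y) p (X p) - mdiff (push f X) p (Y p).
Proof.
by move=> vX vY; apply: lc_bracket => //; exists setT; split=> //; exact: openT.
Qed.

(** The multiple of [f p] removes the second fundamental form of the sphere in R^7. *)
Lemma sffE X Y p : vfield_at p Y ->
  sff X Y p = mdiff (push f Y) p (X p) + dot (push f X p) (push f Y p) *: f p
              - mdiff f p (nabla p (X p) Y).
Proof.
move=> vY; have aY := along_at_push vY.
by rewrite [X in X - _](_ : _ = Dbar p (X p) (push f Y)) // (pcE _ aY) (tproj_mdiff _ aY).
Qed.

Lemma sffC X Y p : vfield_at p X -> vfield_at p Y -> sff X Y p = sff Y X p.
Proof.
move=> vX vY; rewrite (sffE _ vY) (sffE _ vX) (dotC (push f Y p)).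
have := push_bracket vX vY; rewrite (mdiff_subr _ _ (df p)).
generalize (mdiff f p (nabla p (X p) Y)) (mdiff f p (nabla p (Y p) X)).
generalize (mdiff (push f Y) p (X p)) (mdiff (push f X) p (Y p)) => c d a b E.
have -> : c = d + (a - b) by rewrite E addrC subrK.
by move: (_ *: f p) => k; apply/rowP => i; rewrite !mxE; ring.
Qed.

(** [sff X Y p] involves [X] only through [X p], so constant maps can stand for the summands
    although they need not be smooth fields. *)
Lemma sff_suml (I : Type) (s : seq I) (h : I -> R) (F : I -> 'rV[R]_3) X Y p :
  vfield_at p Y -> X p = \sum_(i <- s) h i *: F i ->
  sff X Y p = \sum_(i <- s) h i *: sff (fun=> F i) Y p.
Proof.
move=> vY; rewrite /Defs.sff /push /nablaF => ->; have aY := along_at_push vY.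
have pY0 : Dbar p 0 (push f Y) - mdiff f p (nabla p 0 Y) = 0.
  have := pc_linear Dbar_pc (-1) 0 0 aY; rewrite scaler0 addr0 scaleN1r addNr => ->.
  have := lc_linear nabla_lc (-1) 0 0 vY; rewrite scaler0 addr0 scaleN1r addNr => ->.
  by rewrite -(subrr (0 : 'rV[R]_3)) (mdiff_subr _ _ (df p)) subrr subrr.
elim: s => [|i s IH]; first by rewrite !big_nil.
rewrite !big_cons -IH (pc_linear Dbar_pc)// (lc_linear nabla_lc)// mdiff_linear//.
generalize (Dbar p (F i) (push f Y)) (mdiff f p (nabla p (F i) Y)) => a b.
by rewrite scalerBr opprD addrACA.
Qed.

(** The tangential components of [sff] are symmetric in [X], [Y] by torsion-freeness, and skew in
    [Y], [Z] because [nabla] and the flat derivative are both metric. The index type of the array is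
    that of the fields smooth around [p]. *)
Lemma sff_normal X Y Z p : vfield_at p X -> vfield_at p Y -> vfield_at p Z ->
  dot (sff X Y p) (push f Z p) = 0.
Proof.
move=> vX vY vZ.
pose c (A B C : {A : M -> 'rV[R]_3 | vfield_at p A}) :=
  dot (sff (sval A) (sval B) p) (push f (sval C) p).
apply: (@sym_antisym_eq0 _ _ c _ _ (exist _ X vX) (exist _ Y vY) (exist _ Z vZ)).
  by move=> [A vA] [B vB] [C vC]; rewrite /c /= sffC.
move=> [A vA] [B vB] [C vC]; rewrite /c /=; apply/eqP; rewrite -addr_eq0.
rewrite (sffE _ vB) (sffE _ vC).
have d W : vfield_at p W -> mdifferentiable p (push f W).
  by move=> vW; apply: along_at_differentiable; exact: along_at_push.
have := etrans (esym (mdiff_bilinear (A p) (@bilinear_dot R 7) (d _ vB) (d _ vC)))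
  (lc_metric nabla_lc (A p) vB vC).
have fB : dot (f p) (push f B p) = 0 by exact: dot_immersion_mdiff.
have fC : dot (f p) (push f C p) = 0 by exact: dot_immersion_mdiff.
rewrite /induced_metric -/(push f B p) -/(push f C p); move: fB fC.
generalize (mdiff (push f B) p (A p)) (mdiff (push f C) p (A p)).
generalize (mdiff f p (nabla p (A p) B)) (mdiff f p (nabla p (A p) C)).
generalize (push f A p) (push f B p) (push f C p) (f p) => u v w x v' w' v1 w1 xv xw.
rewrite !(dotDl, dotNl, dotZl) xv xw (dotC v) (dotC v) => E.
by apply/eqP; rewrite !mulr0 !addr0 addrACA E -opprD subrr.
Qed.

Lemma nkG_push X Y p : Gf f D X Y p = tproj (f p) (cross (push f X p) (push f Y p)).
Proof. by rewrite /Gf (nkGE D_lc)//; exact: dot_immersion_mdiff. Qed.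

Hypothesis f_lag : lagrangian f.

Lemma lagrangian_dot p v w : dot (mdiff f p v) (cross (f p) (mdiff f p w)) = 0.
Proof.
have : Defs.normal_space f p (cross (f p) (mdiff f p w)) by rewrite -f_lag; exists w.
by move=> [_]; apply.
Qed.

(** The tangential and radial corrections in [sffE] are orthogonal to J(TM), so only the flat
    derivative survives. *)
Lemma cubicE X Y Z p : vfield_at p Y ->
  cubic X Y Z p = dot (mdiff (push f Y) p (X p)) (pushJ f Z p).
Proof.
move=> vY; rewrite /Defs.cubic sffE// dotDl dotDl dotZl dotNl /pushJ.
by rewrite lagrangian_dot dot_crossl mulr0 oppr0 !addr0.
Qed.

Lemma push_differentiable p X : vfield_at p X -> mdifferentiable p (push f X).
Proof. by move=> vX; apply: along_at_differentiable; exact: along_at_push. Qed.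

Lemma dot_cross_push X Y Z p : vfield_at p Y -> vfield_at p Z ->
  dot (cross (push f X p) (push f Y p)) (push f Z p) = cubic X Y Z p - cubic X Z Y p.
Proof.
move=> vY vZ; rewrite (cubicE _ _ vY) (cubicE _ _ vZ).
have dY := push_differentiable vY; have dZ := push_differentiable vZ.
have dfY := mdifferentiable_bilinear bilinear_cross (df p) dY.
have E1 := mdiff_bilinear (X p) bilinear_cross (df p) dY.
have := mdiff_bilinear (X p) (@bilinear_dot R 7) dfY dZ.
rewrite E1 (_ : (fun q => dot (cross (f q) (push f Y q)) (push f Z q)) = cst 0); last first.
  by apply/funext => q; rewrite dotC; exact: lagrangian_dot.
rewrite mdiff_cst -/(push f X p) /pushJ -/(push f Y p) -/(push f Z p).
generalize (mdiff (push f Y) p (X p)) (mdiff (push f Z) p (X p)).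
generalize (push f X p) (push f Y p) (push f Z p) (f p) => u v w x v1 w1.
rewrite dotDl (dot_cross_skew x v1) (dotC _ w1) => E.
by apply/eqP; rewrite -subr_eq0 opprB addrA addrAC -E eqxx.
Qed.

Lemma cubicC12 X Y Z p : vfield_at p X -> vfield_at p Y ->
  cubic X Y Z p = cubic Y X Z p.
Proof. by move=> vX vY; rewrite /Defs.cubic (sffC vX vY). Qed.

Lemma cubicC23 X Y Z p : vfield_at p X -> vfield_at p Y -> vfield_at p Z ->
  cubic X Y Z p = cubic X Z Y p.
Proof.
move=> vX vY vZ.
have e1 := dot_cross_push X vY vZ; have e2 := dot_cross_push Y vZ vX.
have e3 := dot_cross_push Z vX vY.
have r1 := dot_cross_rot (push f X p) (push f Y p) (push f Z p).
have r2 := dot_cross_rot (push f Y p) (push f Z p) (push f X p).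
rewrite (cubicC12 Z vY vX) in e2.
rewrite (cubicC12 X vZ vY) (cubicC12 Y vZ vX) in e3.
move: (etrans (esym e1) (etrans r1 e2)) (etrans (esym e2) (etrans r2 e3)) => {e1 e2 e3 r1 r2}.
generalize (cubic X Y Z p) (cubic X Z Y p) (cubic Y Z X p) => a b c r1 r2.
(* The three rotations of the triple product are [a - b], [c - a] and [b - c]: equal numbers with
   sum zero. *)
have : (a - b) *+ 3 = 0 by rewrite !mulrS mulr0n addr0 {2 3}r1 {2}r2; ring.
by move/eqP; rewrite mulrn_eq0 /= subr_eq0 => /eqP.
Qed.

Lemma dot_cross_push0 X Y Z p : vfield_at p X -> vfield_at p Y -> vfield_at p Z ->
  dot (cross (push f X p) (push f Y p)) (push f Z p) = 0.
Proof. by move=> vX vY vZ; rewrite dot_cross_push// cubicC23// subrr. Qed.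

End Connection.
End Immersion.

(** * Orthonormal frames *)

(** On three indices an alternating [w] is a multiple of the permutation symbol, so each of the
    three terms survives for a single [m], with the common factor [w 0 1 2]. *)
Lemma trace_of_cyclic (R : realType) (w : 'I_3 -> 'I_3 -> 'I_3 -> R) (h : 'I_3 -> 'I_3 -> R) :
  (forall i j k, w i j k = - w j i k) -> (forall i j k, w i j k = - w i k j) ->
  w 0 1 2 != 0 ->
  \sum_m (h 0 m * w 1 2 m + h 1 m * w 2 0 m + h 2 m * w 0 1 m) = 0 ->
  \sum_m h m m = 0.
Proof.
move=> c12 c23 wn0.
have E0 (x : R) : x = - x -> x = 0.
  by move=> /eqP; rewrite -addr_eq0 -mulr2n mulrn_eq0 /= => /eqP.
have w0 i j : w i i j = 0 by apply: E0; exact: c12.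
have w0' i j : w i j j = 0 by apply: E0; exact: c23.
have w0'' i j : w i j i = 0 by rewrite c23 w0 oppr0.
have w120 : w 1 2 0 = w 0 1 2 by rewrite (c23 1 2 0) (c12 1 0 2) opprK.
have w201 : w 2 0 1 = w 0 1 2 by rewrite (c12 2 0 1) (c23 0 2 1) opprK.
have sum3 (G : 'I_3 -> R) : \sum_m G m = G 0 + G 1 + G 2.
  rewrite !big_ord_recr big_ord0 /= add0r.
  by congr (G _ + G _ + G _); apply/val_inj.
rewrite !sum3 w120 w201 !w0' !w0''.
rewrite !(mulr0, addr0, add0r) -!mulrDl => /eqP.
by rewrite mulf_eq0 (negbTE wn0) orbF => /eqP.
Qed.

Section Frame.
Context {R : realType} {M : smoothManifold (R := R) 3}.
Implicit Types (p q : M) (X Y Z : M -> 'rV[R]_3).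
Variable D : 'rV[R]_7 -> 'rV[R]_7 -> ('rV[R]_7 -> 'rV[R]_7) -> 'rV[R]_7.
Hypothesis D_lc : sphere_levi_civita D.
Variable f : M -> 'rV[R]_7.
Hypothesis f_imm : sphere_immersion f.
Hypothesis f_lag : lagrangian f.
Variable Dbar : M -> 'rV[R]_3 -> (M -> 'rV[R]_7) -> 'rV[R]_7.
Hypothesis Dbar_pc : pullback_connection f D Dbar.
Variable nabla : forall p : M, 'rV[R]_3 -> (M -> 'rV[R]_3) -> 'rV[R]_3.
Hypothesis nabla_lc : levi_civita (induced_metric f) nabla.

Local Notation sff := (sff f Dbar nabla).
Local Notation cubic := (cubic f Dbar nabla).
Local Notation omega := (omega f D).

Let xF p v : dot (f p) (mdiff f p v) = 0.
Proof. exact: dot_immersion_mdiff. Qed.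

(** Rotating the triple product turns this into the Lagrangian condition. Hence the projection in
    [nkGE] acts trivially and G is the bare cross product on M. *)
Lemma cross_push_tangent p v w : dot (f p) (cross (mdiff f p v) (mdiff f p w)) = 0.
Proof.
rewrite dotC dot_cross_rot dot_crossC dotC.
by rewrite (lagrangian_dot f_lag) oppr0.
Qed.

Lemma GfE X Y p : Gf f D X Y p = cross (push f X p) (push f Y p).
Proof. by rewrite (nkG_push f_imm D_lc) tproj_id//; exact: cross_push_tangent. Qed.

Lemma omegaE X Y Z p :
  omega X Y Z p = dot (cross (push f X p) (push f Y p)) (pushJ f Z p).
Proof. by rewrite /Defs.omega GfE. Qed.

Lemma omegaC12 X Y Z p : omega X Y Z p = - omega Y X Z p.
Proof. exact: etrans (omegaE _ _ _ _) (etrans (dot_crossC _ _ _) (congr1 -%R (esym (omegaE _ _ _ _)))). Qed.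

Lemma omegaC23 X Y Z p : omega X Y Z p = - omega X Z Y p.
Proof. have x0 v : dot (mdiff f p v) (f p) = 0 by rewrite dotC.
rewrite (omegaE X Y Z) (omegaE X Z Y); exact: (dot_cross_polar (x0 (X p)) (x0 (Y p)) (x0 (Z p))).
Qed.

Variables (U : set M) (e : 'I_3 -> M -> 'rV[R]_3).
Hypothesis U_open : open U.
Hypothesis e_frame : oriented_orthonormal_frame f D U e.
Variable p : M.
Hypothesis Up : U p.

Local Notation F i := (push f (e i) p).
Local Notation N i := (pushJ f (e i) p).
Local Notation h i j k := (cubic (e i) (e j) (e k) p).
Local Notation w i j k := (omega (e i) (e j) (e k) p).

Lemma vfield_at_frame i : vfield_at p (e i).
Proof. by have [ve _ _] := e_frame; exists U. Qed.

Let ve := vfield_at_frame.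

Lemma dot_frame i j : dot (F i) (F j) = (i == j)%:R.
Proof. by have [_ eo _] := e_frame; exact: eo. Qed.

Lemma induced_metric_suml (a : 'I_3 -> R) v :
  induced_metric f p (\sum_i a i *: e i p) v = \sum_i a i * induced_metric f p (e i p) v.
Proof.
rewrite /induced_metric (mdiff_sumr _ _ _ (immersion_differentiable f_imm p)) dot_suml.
by apply: eq_bigr => i _; rewrite dotZl.
Qed.

Lemma induced_metric_frame (a : 'I_3 -> R) i :
  induced_metric f p (\sum_i a i *: e i p) (e i p) = a i.
Proof.
rewrite induced_metric_suml (bigD1 i)//= big1 => [|j ji].
  by rewrite [induced_metric _ _ _ _]dot_frame eqxx mulr1 addr0.
by rewrite [induced_metric _ _ _ _]dot_frame (negbTE ji) mulr0.
Qed.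

Lemma frame_expand v : v = \sum_i induced_metric f p v (e i p) *: e i p.
Proof.
(* The frame vectors form the rows of a square matrix with trivial left kernel, since pairing with
   [e i p] recovers the coefficients; hence it is invertible. *)
pose E := \matrix_(i < 3) e i p.
have mE (a : 'rV_3) : a *m E = \sum_i a 0 i *: e i p.
  by rewrite mulmx_sum_row; apply: eq_bigr => i _; rewrite rowK.
have E_unit : E \in unitmx.
  rewrite -row_free_unit; apply: inj_row_free => a; rewrite mE => a0.
  apply/rowP => i; rewrite mxE -(induced_metric_frame (fun i => a 0 i)) a0.
  rewrite /induced_metric -(subrr (0 : 'rV_3)).
  by rewrite (mdiff_subr _ _ (immersion_differentiable f_imm p)) subrr dot0l.
have Ev : v = \sum_i (v *m invmx E) 0 i *: e i p by rewrite -mE mulmxKV.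
rewrite [LHS]Ev; apply: eq_bigr => i _; congr (_ *: _).
by rewrite [in RHS]Ev induced_metric_frame.
Qed.

Lemma normal_spaceP z : dot (f p) z = 0 -> (forall i, dot (F i) z = 0) ->
  Defs.normal_space f p z.
Proof.
move=> xz Fz; split=> // v; rewrite (frame_expand v).
rewrite (mdiff_sumr _ _ _ (immersion_differentiable f_imm p)) dot_suml big1// => i _.
by rewrite dotZl [dot _ _]Fz mulr0.
Qed.

Lemma dot_normal_frame i j : dot (N i) (N j) = (i == j)%:R.
Proof.
have [_ f1 _] := f_imm; apply: etrans (dot_cross_cross _ _ _) _.
have E (a b c d : R) : a = 1 -> b = 0 -> a * c - b * d = c.
  by move=> -> ->; rewrite mul1r mul0r subr0.
exact: etrans (E _ _ _ _ (f1 p) (xF p (e i p))) (dot_frame i j).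
Qed.

Lemma dot_frame_normal i j : dot (F i) (N j) = 0.
Proof. exact: lagrangian_dot. Qed.

Lemma normal_expand z : Defs.normal_space f p z -> z = \sum_m dot z (N m) *: N m.
Proof.
rewrite -f_lag => -[v _ <-].
have E : cross (f p) (mdiff f p v) = \sum_m induced_metric f p v (e m p) *: N m.
  rewrite {1}(frame_expand v) (mdiff_sumr _ _ _ (immersion_differentiable f_imm p)).
  by rewrite cross_sumr; apply: eq_bigr => i _; rewrite crossZr.
rewrite [LHS]E; apply: eq_bigr => i _; congr (_ *: _).
rewrite E dot_suml (bigD1 i)//= big1 => [|j ji].
  by rewrite dotZl dot_normal_frame eqxx mulr1 addr0.
by rewrite dotZl dot_normal_frame (negbTE ji) mulr0.
Qed.

Lemma sff_normal_space X Y : vfield_at p X -> vfield_at p Y ->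
  Defs.normal_space f p (sff X Y p).
Proof.
move=> vX vY; apply: normal_spaceP => [|i].
  rewrite dotDr dotNr [dot _ (push _ _ _)]xF oppr0 addr0.
  by apply: (pc_tangent Dbar_pc); exact: along_at_push.
by rewrite dotC; exact: (sff_normal f_imm D_lc Dbar_pc nabla_lc vX vY (ve i)).
Qed.

(** The vector is orthogonal to [f p] and, by [dot_cross_push0], to the whole frame; so it is normal
    and its components along the N_m, which are those of omega, determine it. *)
Lemma cross_frame_expand i j : cross (F i) (F j) = \sum_m w i j m *: N m.
Proof.
rewrite (normal_expand (z := cross (F i) (F j))).
  by apply: eq_bigr => m _; rewrite omegaE.
apply: normal_spaceP => [|k]; first exact: cross_push_tangent.
by rewrite dotC; exact: (dot_cross_push0 f_imm D_lc Dbar_pc nabla_lc f_lag (ve i) (ve j) (ve k)).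
Qed.

Lemma dot_cross_frame l i j k :
  dot (cross (F j) (F k)) (mdiff (push f (e i)) p (e l p)) =
  \sum_m h l i m * w j k m.
Proof.
rewrite cross_frame_expand dot_suml; apply: eq_bigr => m _.
by rewrite dotZl dotC (cubicE f_imm D_lc Dbar_pc nabla f_lag _ _ (ve i)) mulrC.
Qed.

End Frame.

(** * Minimality *)

Section Minimal.
Context {R : realType} {M : smoothManifold (R := R) 3}.
Variable D : 'rV[R]_7 -> 'rV[R]_7 -> ('rV[R]_7 -> 'rV[R]_7) -> 'rV[R]_7.
Hypothesis D_lc : sphere_levi_civita D.
Variable f : M -> 'rV[R]_7.
Hypothesis f_imm : sphere_immersion f.
Hypothesis f_lag : lagrangian f.
Variable Dbar : M -> 'rV[R]_3 -> (M -> 'rV[R]_7) -> 'rV[R]_7.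
Hypothesis Dbar_pc : pullback_connection f D Dbar.
Variable nabla : forall p : M, 'rV[R]_3 -> (M -> 'rV[R]_3) -> 'rV[R]_3.
Hypothesis nabla_lc : levi_civita (induced_metric f) nabla.
Variables (U : set M) (e : 'I_3 -> M -> 'rV[R]_3).
Hypothesis U_open : open U.
Hypothesis e_frame : oriented_orthonormal_frame f D U e.
Variable p : M.
Hypothesis Up : U p.

Local Notation h i j k := (cubic f Dbar nabla (e i) (e j) (e k) p).
Local Notation w i j k := (omega f D (e i) (e j) (e k) p).

(* The derivative of [dot (cross (F i) (F j)) (F k) = 0] in the direction [e l]. *)
Lemma cubic_omega_cyclic l i j k :
  \sum_m (h l i m * w j k m + h l j m * w k i m + h l k m * w i j m) = 0.
Proof.
have ve q m : U q -> vfield_at q (e m) by move=> Uq; exact: (vfield_at_frame U_open e_frame Uq).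
have d m := push_differentiable f_imm (ve p m Up).
have dx := mdifferentiable_bilinear bilinear_cross (d i) (d j).
have E1 := mdiff_bilinear (e l p) bilinear_cross (d i) (d j).
have E2 := mdiff_bilinear (e l p) (@bilinear_dot R 7) dx (d k).
have E3 : mdiff (fun q => dot (cross (push f (e i) q) (push f (e j) q)) (push f (e k) q))
    p (e l p) = 0.
  rewrite -(mdiff_cst p (0 : R) (e l p)); apply: mdiff_near_eq.
  apply: filterS (open_nbhs_nbhs (conj U_open Up)) => q Uq.
  exact: (dot_cross_push0 f_imm D_lc Dbar_pc nabla_lc f_lag (ve q i Uq) (ve q j Uq) (ve q k Uq)).
have {E3} := etrans (esym E2) E3; rewrite E1 {E1 E2} => E.
have s a b c := esym (dot_cross_frame D_lc f_imm f_lag Dbar_pc nabla_lc U_open e_frame Up l a b c).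
rewrite !big_split /=; apply: etrans (congr2 +%R (congr2 +%R (s i j k) (s j k i)) (s k i j)) _.
apply: etrans _ E => {s}.
generalize (mdiff (push f (e i)) p (e l p)) (mdiff (push f (e j)) p (e l p)).
generalize (mdiff (push f (e k)) p (e l p)) => c a b.
generalize (push f (e i) p) (push f (e j) p) (push f (e k) p) => x y z.
by rewrite dotDl -(dot_cross_rot a) (dot_cross_rot z) (dot_cross_rot x b).
Qed.

Lemma cubic_trace l : \sum_m h l m m = 0.
Proof.
apply: (@trace_of_cyclic R (fun i j k => w i j k) (fun i j => h l i j)) => [i j k|i j k||].
- exact: omegaC12.
- exact: omegaC23.
- by rewrite gt_eqF//; have [_ _] := e_frame; apply.
- exact: cubic_omega_cyclic.
Qed.

End Minimal.

(** * Symmetries of component arrays *)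

Section Algebra.
Context {R : realType}.

(** The three adjacent transpositions give all six, and every permutation is a product of
    transpositions. *)
Lemma totally_symmetricP (t : 'I_3 -> 'I_3 -> 'I_3 -> 'I_3 -> R) :
  (forall a b c d, t a b c d = t b a c d) -> (forall a b c d, t a b c d = t a c b d) ->
  (forall a b c d, t a b c d = t a b d c) -> totally_symmetric t.
Proof.
move=> s01 s12 s23.
have s02 a b c d : t a b c d = t c b a d by rewrite s01 s12 s01.
have s13 a b c d : t a b c d = t a d c b by rewrite s12 s23 s12.
have s03 a b c d : t a b c d = t d b c a by rewrite s01 s13 s01.
have swap (x y : 'I_4) (a : 'I_4 -> 'I_3) :
    t (a (tperm x y 0)) (a (tperm x y 1)) (a (tperm x y 2)) (a (tperm x y 3)) =
    t (a 0) (a 1) (a 2) (a 3).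
  (* Indices are normalized to [inord] of their values, so that the sixteen cases for [x] and [y]
     reduce by computation. *)
  have aE i : a i = a (inord (val i)) by rewrite inord_val.
  rewrite !(aE (tperm _ _ _)) !(aE 0) !(aE 1) !(aE 2) !(aE 3) !permE /=.
  by case: x => -[|[|[|[|//]]]] ?; case: y => -[|[|[|[|//]]]] ? /=.
move=> s; case: (prod_tpermP s) => ts -> _; elim: ts => [|[x y] ts IH] a.
  by rewrite big_nil !perm1.
by rewrite big_cons !permM /= (swap x y (fun i => a ((\prod_(t <- ts) tperm t.1 t.2)%g i))).
Qed.

Lemma sum_sym_antisym (I : finType) (a b : I -> I -> R) :
  (forall i j, a i j = - a j i) -> (forall i j, b i j = b j i) ->
  \sum_i \sum_j a i j * b i j = 0.
Proof.
move=> ha hb; set S := \sum_i _; have : S = - S.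
  rewrite {1}/S exchange_big /= -sumrN; apply: eq_bigr => i _; rewrite -sumrN.
  by apply: eq_bigr => j _; rewrite ha hb mulNr.
by move/eqP; rewrite -addr_eq0 -mulr2n mulrn_eq0 /= => /eqP.
Qed.

(* Two instances of the cyclic identity, for [(j; l, k, i)] and [(i; l, k, j)]. *)
Lemma cyclic_rearrange (I : finType) (h w : I -> I -> I -> R) :
  (forall i j k, h i j k = h j i k) -> (forall i j k, h i j k = h i k j) ->
  (forall i j k, w i j k = - w j i k) -> (forall i j k, w i j k = - w i k j) ->
  (forall l i j k,
    \sum_m (h l i m * w j k m + h l j m * w k i m + h l k m * w i j m) = 0) ->
  forall l i j k,
    4^-1 * (\sum_m h i m j * w l m k + \sum_m h j m l * w i m k + \sum_m h l m i * w j m k)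
    + \sum_m h i j m * w l k m =
    4^-1 * \sum_m (w l i m * h m j k + w l j m * h i m k + w l k m * h i j m).
Proof.
move=> h12 h23 w12 w23 P l i j k.
have := congr2 +%R (P j l k i) (P i l k j); rewrite addr0 -big_split /= => E.
rewrite -!big_split /=.
have -> : \sum_m h i j m * w l k m = 4^-1 * \sum_m 4 * (h i j m * w l k m).
  by rewrite -mulr_sumr mulrA mulVf ?mul1r// pnatr_eq0.
rewrite -mulrDr -big_split /=; congr (_ * _).
apply/eqP; rewrite -subr_eq0 -sumrB; apply/eqP; apply: etrans _ E; apply: eq_bigr => m _.
rewrite (h23 i m j) (h23 j m l) (h23 l m i) (h12 l i m) (h12 m j k) (h23 j m k).
rewrite (h23 i m k) (h12 j i m) (w23 l m k) (w23 i m k) (w12 i k m) (w23 j m k) (w12 j k m).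
by rewrite (w12 i l m) (w12 j l m); ring.
Qed.

(** Each swap exchanges two of the three summands and fixes the third. Thus T has the symmetries in
    i, j, k that h_ijk;l has. *)
Lemma correction_sym (I : finType) (h w : I -> I -> I -> R) :
  (forall i j k, h i j k = h j i k) -> (forall i j k, h i j k = h i k j) ->
  let S l i j k := \sum_m (w l i m * h m j k + w l j m * h i m k + w l k m * h i j m) in
  (forall l i j k, S l i j k = S l j i k) /\ (forall l i j k, S l i j k = S l i k j).
Proof.
move=> h12 h23 S; split=> l i j k; apply: eq_bigr => m _.
  by rewrite (h12 j m k) (h12 m i k) (h12 j i m); ring.
by rewrite (h23 m k j) (h23 i m j) (h23 i k m); ring.
Qed.

(** The first two terms contract the skew [w l] with a symmetric array, and the third contains the
    trace of [h]. *)
Lemma correction_trace (I : finType) (h w : I -> I -> I -> R) :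
  (forall i j k, h i j k = h j i k) -> (forall i j k, w i j k = - w i k j) ->
  (forall k, \sum_m h m m k = 0) -> forall l k,
  \sum_m \sum_n (w l m n * h n m k + w l m n * h m n k + w l k n * h m m n) = 0.
Proof.
move=> h12 w23 h0 l k.
transitivity (\sum_m \sum_n w l m n * h n m k + \sum_m \sum_n w l m n * h m n k +
              \sum_m \sum_n w l k n * h m m n).
  by rewrite -!big_split; apply: eq_bigr => m _; rewrite -!big_split.
rewrite (sum_sym_antisym (w23 l) (fun m n => h12 n m k)).
rewrite (sum_sym_antisym (w23 l) (fun m n => h12 m n k)) exchange_big /= !add0r big1// => n _.
by rewrite -mulr_sumr h0 mulr0.
Qed.

End Algebra.

(** * The tensor [T] *)

Section SymmetricTensor.
Context {R : realType} {M : smoothManifold (R := R) 3}.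
Implicit Types (q : M) (X Y Z W : M -> 'rV[R]_3).
Variable D : 'rV[R]_7 -> 'rV[R]_7 -> ('rV[R]_7 -> 'rV[R]_7) -> 'rV[R]_7.
Hypothesis D_lc : sphere_levi_civita D.
Variable f : M -> 'rV[R]_7.
Hypothesis f_imm : sphere_immersion f.
Hypothesis f_lag : lagrangian f.
Variable Dbar : M -> 'rV[R]_3 -> (M -> 'rV[R]_7) -> 'rV[R]_7.
Hypothesis Dbar_pc : pullback_connection f D Dbar.
Variable nabla : forall p : M, 'rV[R]_3 -> (M -> 'rV[R]_3) -> 'rV[R]_3.
Hypothesis nabla_lc : levi_civita (induced_metric f) nabla.
Variables (U : set M) (e : 'I_3 -> M -> 'rV[R]_3).
Hypothesis U_open : open U.
Hypothesis e_frame : oriented_orthonormal_frame f D U e.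

Local Notation sff := (sff f Dbar nabla).
Local Notation cubic := (cubic f Dbar nabla).
Local Notation omega := (omega f D).
Local Notation nablaF := (nablaF nabla).

Let veU i : vfield U (e i). Proof. by have [h _ _] := e_frame. Qed.
Let ve q i : U q -> vfield_at q (e i). Proof. by exists U. Qed.

Let vnU i j : vfield U (nablaF (e i) (e j)).
Proof. exact: (lc_smooth nabla_lc U_open (veU i) (veU j)). Qed.
Let vn q i j : U q -> vfield_at q (nablaF (e i) (e j)). Proof. by exists U. Qed.

Lemma along_sff i j : along f U (sff (e i) (e j)).
Proof.
have [s1 t1] := pc_smooth Dbar_pc U_open (veU i) (along_push f_imm U_open (veU j)).
have [s2 t2] := along_push f_imm U_open (@vnU i j).
split=> [|q Uq]; first by apply: msmoothD => //; exact: msmoothN.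
by rewrite [X in dot _ X]/Defs.sff dotDr dotNr t1// t2// oppr0 addr0.
Qed.

Variable p : M.
Hypothesis Up : U p.

Local Notation F i := (push f (e i) p).
Local Notation N i := (pushJ f (e i) p).
Local Notation h i j k := (cubic (e i) (e j) (e k) p).
Local Notation w i j k := (omega (e i) (e j) (e k) p).

Lemma cubic_sym12 i j k : h i j k = h j i k.
Proof. exact: (cubicC12 f_imm D_lc Dbar_pc nabla_lc (e k) (ve i Up) (ve j Up)). Qed.

Lemma cubic_sym23 i j k : h i j k = h i k j.
Proof.
exact: (cubicC23 f_imm D_lc Dbar_pc nabla_lc f_lag (ve i Up) (ve j Up) (ve k Up)).
Qed.

Lemma cubic_expand X Y Z : vfield_at p Y ->
  cubic X Y Z p = \sum_m induced_metric f p (X p) (e m p) * cubic (e m) Y Z p.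
Proof.
move=> vY; have S := sff_suml f_imm Dbar_pc nabla_lc vY (frame_expand f_imm e_frame Up (X p)).
apply: etrans (congr1 (fun z => dot z (pushJ f Z p)) S) _.
by apply: etrans (dot_suml _ _ _) _; apply: eq_bigr => m _; exact: dotZl.
Qed.

Let nJ k : Defs.normal_space f p (N k).
Proof. by rewrite -f_lag; exists (e k p). Qed.

(** Subtracting from [Dbar p (X p) xi] its components along the frame gives an admissible normal
    part. Pairing with N_k discards the tangential part of whichever decomposition [get] selects. *)
Lemma dot_nabla_perp X (xi : M -> 'rV[R]_7) k : along_at f p xi ->
  dot (nabla_perp f Dbar X xi p) (N k) = dot (mdiff xi p (X p)) (N k).
Proof.
move=> axi; rewrite /nabla_perp.
set P := [set z | _].
have exP : exists z, P z.
  set u := Dbar p (X p) xi; set v := \sum_i dot u (F i) *: e i p.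
  exists (u - mdiff f p v); split; last by exists v; rewrite addrC subrK.
  apply: (normal_spaceP f_imm e_frame Up) => [|i].
    rewrite dotDr dotNr (dot_immersion_mdiff f_imm p v) oppr0 addr0.
    exact: (pc_tangent Dbar_pc).
  apply: etrans (dotDr _ _ _) _; rewrite dotNr (dotC (F i) (mdiff f p v)).
  have Fi : dot (mdiff f p v) (F i) = dot u (F i).
    exact: (induced_metric_frame f_imm e_frame Up (fun i => dot u (F i)) i).
  by rewrite Fi (dotC (F i)) subrr.
have [_ [v E]] := getPex exP.
have -> : dot (get P) (N k) = dot (Dbar p (X p) xi) (N k).
  by rewrite E dotDl [X in X + _](lagrangian_dot f_lag) add0r.
rewrite (pcE f_imm D_lc Dbar_pc _ axi) (tproj_mdiff f_imm _ axi) dotDl dotZl.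
by rewrite (nJ k).1 mulr0 addr0.
Qed.

Lemma dot_nabla_sff l i j k :
  dot (nabla_sff f Dbar nabla (e l) (e i) (e j) p) (N k) =
  dot (mdiff (sff (e i) (e j)) p (e l p)) (N k)
  - cubic (nablaF (e l) (e i)) (e j) (e k) p - cubic (e i) (nablaF (e l) (e j)) (e k) p.
Proof.
have axi : along_at f p (sff (e i) (e j)) by exists U; split=> //; exact: along_sff.
have lin (a b c z : 'rV[R]_7) : dot (a - b - c) z = dot a z - dot b z - dot c z.
  by rewrite !dotDl !dotNl.
apply: etrans (lin _ _ _ _) _.
exact: (congr1 (fun t => t - _ - _) (dot_nabla_perp (e l) k axi)).
Qed.

Let dF i := push_differentiable f_imm (ve i Up).
Let dx := immersion_differentiable f_imm p.

Let dS i j : mdifferentiable p (sff (e i) (e j)).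
Proof. by apply: (@along_at_differentiable _ _ f); exists U; split=> //; exact: along_sff. Qed.

Let dN k : mdifferentiable p (pushJ f (e k)).
Proof. exact: (mdifferentiable_bilinear bilinear_cross dx (dF k)). Qed.

(** J exchanges the tangent and normal spaces. Writing the first vector as J of a tangent vector and
    using that J is orthogonal leaves the product of a tangent and a normal vector. *)
Lemma dot_normal_cross i j l k :
  dot (sff (e i) (e j) p) (cross (f p) (sff (e l) (e k) p)) = 0.
Proof.
have n1 := sff_normal_space D_lc f_imm Dbar_pc nabla_lc U_open e_frame Up (ve i Up) (ve j Up).
have [n2 n3] := sff_normal_space D_lc f_imm Dbar_pc nabla_lc U_open e_frame Up (ve l Up) (ve k Up).
move: n1; rewrite -f_lag => -[v _ <-]; apply: etrans (dot_cross_cross _ _ _) _.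
by rewrite n3 n2 !mulr0 subrr.
Qed.

Lemma nabla_cubicE l i j k :
  nabla_cubic f Dbar nabla (e l) (e i) (e j) (e k) p =
  dot (nabla_sff f Dbar nabla (e l) (e i) (e j) p) (N k) + \sum_m h i j m * w l k m.
Proof.
have E1 : mdiff (cubic (e i) (e j) (e k)) p (e l p) =
    dot (mdiff (sff (e i) (e j)) p (e l p)) (N k) +
    dot (sff (e i) (e j) p) (mdiff (pushJ f (e k)) p (e l p)).
  exact: (mdiff_bilinear _ (@bilinear_dot R 7) (dS i j) (dN k)).
have E2 : mdiff (pushJ f (e k)) p (e l p) =
    cross (F l) (F k) + cross (f p) (mdiff (push f (e k)) p (e l p)).
  exact: (mdiff_bilinear _ bilinear_cross dx (dF k)).
have E3 : mdiff (push f (e k)) p (e l p) = sff (e l) (e k) p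
    + push f (nablaF (e l) (e k)) p - dot (F l) (F k) *: f p.
  rewrite (sffE f_imm D_lc Dbar_pc nabla (e l) (ve k Up)) -/(push f (nablaF (e l) (e k)) p).
  generalize (mdiff (push f (e k)) p (e l p)) (push f (nablaF (e l) (e k)) p).
  by generalize (dot (F l) (F k) *: f p) => a b c; rewrite subrK addrK.
have E4 : dot (sff (e i) (e j) p) (cross (F l) (F k)) = \sum_m h i j m * w l k m.
  rewrite (cross_frame_expand D_lc f_imm f_lag Dbar_pc nabla_lc U_open e_frame Up).
  rewrite dot_sumr; apply: eq_bigr => m _; rewrite dotZr mulrC; congr (_ * _).
(* Of the three parts of the flat derivative in [E3], the normal one drops by [dot_normal_cross] and
   the radial one since x x x = 0; the tangential one cancels the last term of [nabla_cubic]. *)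
have E5 : dot (sff (e i) (e j) p) (cross (f p) (mdiff (push f (e k)) p (e l p))) =
    cubic (e i) (e j) (nablaF (e l) (e k)) p.
  have lin (s x a b : 'rV[R]_7) c :
      dot s (cross x (a + b - c *: x)) = dot s (cross x a) + dot s (cross x b).
    by rewrite crossDr crossDr -scaleNr crossZr crossxx scaler0 addr0 dotDr.
  rewrite E3; apply: etrans (lin _ _ _ _ _) _.
  by rewrite dot_normal_cross add0r.
have alg (A a t x y z : R) : A = a + (t + z) -> A - x - y - z = (a - x - y) + t.
  by move=> ->; ring.
have E6 := etrans (congr1 (dot _) E2) (etrans (dotDr _ _ _) (congr2 +%R E4 E5)).
apply: etrans (alg _ _ _ _ _ _ (etrans E1 (congr1 (+%R _) E6))) _.
exact: (congr1 (+%R^~ _) (esym (dot_nabla_sff l i j k))).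
Qed.

(** The right side satisfies the defining condition of [shape_op] for every smooth [Y]; conversely,
    testing the chosen vector against the frame determines its components. *)
Lemma shape_opE i k :
  shape_op f Dbar nabla (pushJ f (e k)) (e i) p = \sum_m h i m k *: e m p.
Proof.
rewrite /shape_op; set P := [set a | _].
have exP : exists a, P a.
  exists (\sum_m h i m k *: e m p) => Y vY.
  rewrite (induced_metric_suml f_imm).
  apply: etrans _ (cubicC12 f_imm D_lc Dbar_pc nabla_lc (e k) vY (ve i Up)).
  apply: etrans _ (esym (cubic_expand Y (e k) (ve i Up))); apply: eq_bigr => m _.
  by rewrite (cubic_sym12 i) mulrC; exact: (congr1 ( *%R^~ _) (dotC _ _)).
have Pa := getPex exP; rewrite [LHS](frame_expand f_imm e_frame Up).
by apply: eq_bigr => m _; congr (_ *: _); exact: (Pa _ (ve m Up)).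
Qed.

Lemma dot_Gf_shape_op l i j k :
  dot (Gf f D (e l) (shape_op f Dbar nabla (pushJ f (e j)) (e i)) p) (N k) =
  \sum_m h i m j * w l m k.
Proof.
rewrite (GfE D_lc f_imm f_lag) [push _ (shape_op _ _ _ _ _) p]/push shape_opE.
rewrite (mdiff_sumr _ _ _ dx) cross_sumr dot_suml; apply: eq_bigr => m _.
by rewrite crossZr dotZl (omegaE D_lc f_imm f_lag).
Qed.

Local Notation T l i j k := (tensorT4 f D Dbar nabla (e l) (e i) (e j) (e k) p).

Lemma tensorT4E l i j k : T l i j k =
  dot (nabla_sff f Dbar nabla (e l) (e i) (e j) p) (N k)
  - 4^-1 * (\sum_m h i m j * w l m k + \sum_m h j m l * w i m k + \sum_m h l m i * w j m k).
Proof.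
have lin (a b c d z : 'rV[R]_7) (t : R) :
    dot (a - t *: (b + c + d)) z = dot a z - t * (dot b z + dot c z + dot d z).
  by rewrite dotDl dotNl dotZl !dotDl.
apply: etrans (lin _ _ _ _ _ _) _.
exact: (congr1 (fun r => _ - 4^-1 * r) (congr2 +%R (congr2 +%R
  (dot_Gf_shape_op l i j k) (dot_Gf_shape_op i j l k)) (dot_Gf_shape_op j l i k))).
Qed.

Lemma nabla_cubic_tensorT4 l i j k :
  nabla_cubic f Dbar nabla (e l) (e i) (e j) (e k) p =
  T l i j k + 4^-1 * \sum_m (w l i m * h m j k + w l j m * h i m k + w l k m * h i j m).
Proof.
have C := @cyclic_rearrange R _ (fun i j k => h i j k) (fun i j k => w i j k)
  cubic_sym12 cubic_sym23 (fun i j k => omegaC12 D_lc f_imm f_lag _ _ _ p)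
  (fun i j k => omegaC23 D_lc f_imm f_lag _ _ _ p)
  (cubic_omega_cyclic D_lc f_imm f_lag Dbar_pc nabla_lc U_open e_frame Up) l i j k.
have alg (n a s t g r : R) : n = a + s -> t = a - g -> g + s = r -> n = t + r.
  by move=> -> -> <-; rewrite addrA subrK.
exact: (alg _ _ _ _ _ _ (nabla_cubicE l i j k) (tensorT4E l i j k) C).
Qed.

(** The symmetry of [cubic] holds on all of [U], so it can be differentiated, and it applies to the
    fields [nablaF (e l) (e i)] as well; the corrections for [i] and [j] trade places. *)
Lemma nabla_cubic_sym12 l i j k :
  nabla_cubic f Dbar nabla (e l) (e i) (e j) (e k) p =
  nabla_cubic f Dbar nabla (e l) (e j) (e i) (e k) p.
Proof.
have C12 X Y Z := @cubicC12 _ _ _ f_imm _ D_lc _ Dbar_pc _ nabla_lc X Y Z.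
have alg (a a' x y z x' y' z' : R) : a = a' -> x = y' -> y = x' -> z = z' ->
    a - x - y - z = a' - x' - y' - z' by move=> -> -> -> ->; ring.
apply: alg.
- apply: mdiff_near_eq; apply: filterS (open_nbhs_nbhs (conj U_open Up)) => q Uq.
  exact: (C12 _ _ _ _ (ve i Uq) (ve j Uq)).
- exact: (C12 _ _ _ _ (vn l i Up) (ve j Up)).
- exact: (C12 _ _ _ _ (ve i Up) (vn l j Up)).
- exact: (C12 _ _ _ _ (ve i Up) (ve j Up)).
Qed.

Lemma nabla_cubic_sym23 l i j k :
  nabla_cubic f Dbar nabla (e l) (e i) (e j) (e k) p =
  nabla_cubic f Dbar nabla (e l) (e i) (e k) (e j) p.
Proof.
have C23 X Y Z := @cubicC23 _ _ _ f_imm _ D_lc _ Dbar_pc _ nabla_lc f_lag X Y Z.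
have alg (a a' x y z x' y' z' : R) : a = a' -> x = x' -> y = z' -> z = y' ->
    a - x - y - z = a' - x' - y' - z' by move=> -> -> -> ->; ring.
apply: alg.
- apply: mdiff_near_eq; apply: filterS (open_nbhs_nbhs (conj U_open Up)) => q Uq.
  exact: (C23 _ _ _ _ (ve i Uq) (ve j Uq) (ve k Uq)).
- exact: (C23 _ _ _ _ (vn l i Up) (ve j Up) (ve k Up)).
- exact: (C23 _ _ _ _ (ve i Up) (vn l j Up) (ve k Up)).
- exact: (C23 _ _ _ _ (ve i Up) (ve j Up) (vn l k Up)).
Qed.

(** Flat first derivatives d_i F_j, kept as functions on M so that they can be differentiated again
    in the Codazzi equation. *)
Let Q i j q := mdiff (push f (e j)) q (e i q).

Let dQ i j : mdifferentiable p (Q i j).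
Proof.
apply: msmooth_at_differentiable; exists U; split=> //.
by apply: msmooth_mdiff => //; have [] := along_push f_imm U_open (veU j).
Qed.

(** On [U] the radial term of [sffE] is the constant (i == j) times [f]; its derivative is a
    multiple of F_l, hence tangent and invisible to N_k. *)
Lemma dot_mdiff_sff l i j k :
  dot (mdiff (sff (e i) (e j)) p (e l p)) (N k) =
  dot (mdiff (Q i j) p (e l p)) (N k) - cubic (e l) (nablaF (e i) (e j)) (e k) p.
Proof.
have dW := push_differentiable f_imm (vn i j Up).
have -> : mdiff (sff (e i) (e j)) p (e l p) = mdiff (Q i j) p (e l p)
    + (i == j)%:R *: F l - mdiff (push f (nablaF (e i) (e j))) p (e l p).
  apply: etrans _ (mdiff_lincomb (i == j)%:R (e l p) (dQ i j) dx dW).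
  apply: mdiff_near_eq; apply: filterS (open_nbhs_nbhs (conj U_open Up)) => q Uq.
  apply: etrans (sffE f_imm D_lc Dbar_pc nabla (e i) (ve j Uq)) _.
  exact: (congr1 (fun t => _ + t *: _ - _) (dot_frame e_frame Uq i j)).
have lin (a b c z : 'rV[R]_7) t : dot b z = 0 -> dot (a + t *: b - c) z = dot a z - dot c z.
  by move=> bz; rewrite !dotDl dotNl dotZl bz mulr0 addr0.
apply: etrans (lin _ _ _ _ _ (dot_frame_normal f_lag e p l k)) _.
exact: (congr1 (fun t => _ - t)
  (esym (cubicE f_imm D_lc Dbar_pc nabla f_lag (e l) (e k) (vn i j Up)))).
Qed.

(* The Codazzi equation: the sphere has constant curvature, so that the curvature
   term has no normal component.  Here the curvature of R^7 vanishes by the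
   torsion-freeness of [nabla], applied to the components of [push f (e j)]. *)
Lemma codazzi l i j k :
  dot (nabla_sff f Dbar nabla (e l) (e i) (e j) p) (N k) =
  dot (nabla_sff f Dbar nabla (e i) (e l) (e j) p) (N k).
Proof.
have sF : msmooth_at p (push f (e j)).
  by exists U; split=> //; have [] := along_push f_imm U_open (veU j).
have B := lc_bracket nabla_lc (ve l Up) (ve i Up) sF.
have E : cubic (nablaF (e l) (e i)) (e j) (e k) p - cubic (nablaF (e i) (e l)) (e j) (e k) p =
    dot (mdiff (Q i j) p (e l p)) (N k) - dot (mdiff (Q l j) p (e i p)) (N k).
  have lin (a b z : 'rV[R]_7) : dot (a - b) z = dot a z - dot b z by rewrite dotDl dotNl.
  apply: etrans (congr2 (fun a b => a - b)
    (cubicE f_imm D_lc Dbar_pc nabla f_lag (nablaF (e l) (e i)) (e k) (ve j Up))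
    (cubicE f_imm D_lc Dbar_pc nabla f_lag (nablaF (e i) (e l)) (e k) (ve j Up))) _.
  apply: etrans (esym (lin _ _ _)) _; apply: etrans _ (lin _ _ _).
  exact: (congr1 (fun t => dot t (N k)) (etrans (esym (mdiff_subr _ _ (dF j))) B)).
(* Both sides contain the mixed terms [x] and [y], for [cubic (e l) (nablaF (e i) (e j))] and
   [cubic (e i) (nablaF (e l) (e j))]; what remains is the bracket identity [E]. *)
have alg (a a' b b' c c' x y m m' : R) : m = b - x -> m' = b' - y -> c - c' = b - b' ->
    a = m - c - y -> a' = m' - c' - x -> a = a'.
  move=> -> -> E1 -> ->; apply/eqP; rewrite -subr_eq0; apply/eqP.
  by transitivity ((b - b') - (c - c')); [ring|rewrite E1 subrr].
exact: (alg _ _ _ _ _ _ _ _ _ _ (dot_mdiff_sff l i j k) (dot_mdiff_sff i l j k) E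
  (dot_nabla_sff l i j k) (dot_nabla_sff i l j k)).
Qed.

(** The Codazzi equation handles the derivative; the swap exchanges the first two G-terms and fixes
    the third, because h_abc = h_cba. *)
Lemma tensorT4_sym01 l i j k : T l i j k = T i l j k.
Proof.
have rev a b c : h a b c = h c b a by rewrite cubic_sym12 cubic_sym23 cubic_sym12.
have alg (t t' a a' x y z x' y' z' : R) : t = a - 4^-1 * (x + y + z) ->
    t' = a' - 4^-1 * (x' + y' + z') -> a = a' -> x = y' -> y = x' -> z = z' -> t = t'.
  by move=> -> -> -> -> -> ->; rewrite (addrC y').
by apply: (alg _ _ _ _ _ _ _ _ _ _ (tensorT4E l i j k) (tensorT4E i l j k) (codazzi l i j k));
  apply: eq_bigr => m _; apply: (congr1 ( *%R^~ _)); exact: rev.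
Qed.

Let S l i j k := \sum_m (w l i m * h m j k + w l j m * h i m k + w l k m * h i j m).

Let tensorT4_nabla_cubic l i j k :
  T l i j k = nabla_cubic f Dbar nabla (e l) (e i) (e j) (e k) p - 4^-1 * S l i j k.
Proof.
have alg (a b c : R) : a = b + c -> b = a - c by move=> ->; rewrite addrK.
exact: (alg _ _ _ (nabla_cubic_tensorT4 l i j k)).
Qed.

Let S_sym := @correction_sym R _ (fun i j k => h i j k) (fun i j k => w i j k)
  cubic_sym12 cubic_sym23.

Lemma tensorT4_sym12 l i j k : T l i j k = T l j i k.
Proof.
apply: etrans (tensorT4_nabla_cubic l i j k) (etrans _ (esym (tensorT4_nabla_cubic l j i k))).
exact: (congr2 (fun a b => a - 4^-1 * b) (nabla_cubic_sym12 l i j k) (S_sym.1 l i j k)).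
Qed.

Lemma tensorT4_sym23 l i j k : T l i j k = T l i k j.
Proof.
apply: etrans (tensorT4_nabla_cubic l i j k) (etrans _ (esym (tensorT4_nabla_cubic l i k j))).
exact: (congr2 (fun a b => a - 4^-1 * b) (nabla_cubic_sym23 l i j k) (S_sym.2 l i j k)).
Qed.

(** Stated at every point of [U], because the trace is differentiated in [nabla_cubic_trace]. *)
Lemma cubic_trace12 q k : U q -> \sum_m cubic (e m) (e m) (e k) q = 0.
Proof.
move=> Uq; apply: etrans _
  (cubic_trace D_lc f_imm f_lag Dbar_pc nabla_lc U_open e_frame Uq k).
apply: eq_bigr => m _.
apply: etrans (cubicC23 f_imm D_lc Dbar_pc nabla_lc f_lag (ve m Uq) (ve m Uq) (ve k Uq)) _.
exact: (cubicC12 f_imm D_lc Dbar_pc nabla_lc (e m) (ve m Uq) (ve k Uq)).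
Qed.

(** The connection forms of an orthonormal frame are skew, since its inner products are constant on
    [U]. *)
Lemma nabla_frame_antisym l m n :
  induced_metric f p (nabla p (e l p) (e m)) (e n p) =
  - induced_metric f p (nabla p (e l p) (e n)) (e m p).
Proof.
have := lc_metric nabla_lc (e l p) (ve m Up) (ve n Up).
have -> : mdiff (fun q => induced_metric f q (e m q) (e n q)) p (e l p) = 0.
  apply: etrans (mdiff_cst p ((m == n)%:R : R) (e l p)); apply: mdiff_near_eq.
  apply: filterS (open_nbhs_nbhs (conj U_open Up)) => q Uq; exact: (dot_frame e_frame Uq).
have alg (a b c : R) : b = c -> 0 = a + b -> a = - c.
  by move=> -> /esym/eqP; rewrite addr_eq0 => /eqP.
by apply: alg; exact: dotC.
Qed.

(** The trace of the cubic form vanishes identically. The corrections on the contracted slots pair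
    skew connection forms with the symmetric h, and the last one is again a trace of h. *)
Lemma nabla_cubic_trace l k :
  \sum_m nabla_cubic f Dbar nabla (e l) (e m) (e m) (e k) p = 0.
Proof.
have C12 X Y Z := @cubicC12 _ _ _ f_imm _ D_lc _ Dbar_pc _ nabla_lc X Y Z.
have C23 X Y Z := @cubicC23 _ _ _ f_imm _ D_lc _ Dbar_pc _ nabla_lc f_lag X Y Z.
have s0 : \sum_m mdiff (cubic (e m) (e m) (e k)) p (e l p) = 0.
  have dc m : mdifferentiable p (cubic (e m) (e m) (e k)).
    exact: (mdifferentiable_bilinear (@bilinear_dot R 7) (dS m m) (dN k)).
  apply: etrans (esym (mdiff_sum _ (e l p) dc)) _.
  apply: etrans (mdiff_cst p (0 : R) (e l p)); apply: mdiff_near_eq.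
  apply: filterS (open_nbhs_nbhs (conj U_open Up)) => q Uq; exact: cubic_trace12.
have s1 : \sum_m cubic (nablaF (e l) (e m)) (e m) (e k) p = 0.
  apply: etrans (eq_bigr _ (fun m _ => cubic_expand _ _ (ve m Up))) _.
  exact: (sum_sym_antisym (nabla_frame_antisym l) (fun m n => cubic_sym12 n m k)).
have s2 : \sum_m cubic (e m) (nablaF (e l) (e m)) (e k) p = 0.
  apply: etrans _ s1; apply: eq_bigr => m _; exact: (C12 _ _ _ _ (ve m Up) (vn l m Up)).
have s3 : \sum_m cubic (e m) (e m) (nablaF (e l) (e k)) p = 0.
  transitivity (\sum_m \sum_n
      induced_metric f p (nablaF (e l) (e k) p) (e n p) * h n m m).
    apply: eq_bigr => m _; apply: etrans _ (cubic_expand _ _ (ve m Up)).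
    apply: etrans (C23 _ _ _ _ (ve m Up) (ve m Up) (vn l k Up)) _.
    exact: (C12 _ _ _ _ (ve m Up) (vn l k Up)).
  rewrite exchange_big /= big1// => n _; rewrite -mulr_sumr.
  have h0 := cubic_trace D_lc f_imm f_lag Dbar_pc nabla_lc U_open e_frame Up n.
  exact: etrans (congr1 ( *%R _) h0) (mulr0 _).
have alg (a b c d : 'I_3 -> R) : \sum_m a m = 0 -> \sum_m b m = 0 -> \sum_m c m = 0 ->
    \sum_m d m = 0 -> \sum_m (a m - b m - c m - d m) = 0.
  by move=> a0 b0 c0 d0; rewrite !sumrB a0 b0 c0 d0 !subr0.
exact: (alg _ _ _ _ s0 s1 s2 s3).
Qed.

Lemma tensorT4_trace j k : \sum_m T m m j k = 0.
Proof.
have -> : \sum_m T m m j k = \sum_m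
    (nabla_cubic f Dbar nabla (e j) (e m) (e m) (e k) p - 4^-1 * S j m m k).
  (* The contraction is moved from the first two slots to the middle ones, T_mmjk = T_jmmk, so that
     the derivative index stays free. *)
  apply: eq_bigr => m _; apply: etrans (tensorT4_sym12 m m j k) _.
  exact: (etrans (tensorT4_sym01 m j m k) (tensorT4_nabla_cubic j m m k)).
have s0 : \sum_m S j m m k = 0.
  exact: (@correction_trace R _ (fun i j k => h i j k) (fun i j k => w i j k)
    cubic_sym12 (fun i j k => omegaC23 D_lc f_imm f_lag _ _ _ p)
    (fun k => cubic_trace12 k Up) j k).
by rewrite sumrB -mulr_sumr s0 mulr0 subr0; exact: nabla_cubic_trace.
Qed.

End SymmetricTensor.

Theorem lemma2p1 (R : realType)
  (D : 'rV[R]_7 -> 'rV[R]_7 -> ('rV[R]_7 -> 'rV[R]_7) -> 'rV[R]_7)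
  (D_lc : sphere_levi_civita D)
  (M : smoothManifold (R := R) 3)
  (f : M -> 'rV[R]_7)
  (f_imm : sphere_immersion f)
  (f_lag : lagrangian f)
  (Dbar : M -> 'rV[R]_3 -> (M -> 'rV[R]_7) -> 'rV[R]_7)
  (Dbar_pc : pullback_connection f D Dbar)
  (nabla : M -> 'rV[R]_3 -> (M -> 'rV[R]_3) -> 'rV[R]_3)
  (nabla_lc : levi_civita (induced_metric f) nabla)
  (U : set M) (U_open : open U)
  (e : 'I_3 -> M -> 'rV[R]_3)
  (e_frame : oriented_orthonormal_frame f D U e)
  (p : M) (Up : U p) :
  let h i j k := cubic f Dbar nabla (e i) (e j) (e k) p in
  let dh i j k l := nabla_cubic f Dbar nabla (e l) (e i) (e j) (e k) p in
  let w i j k := omega f D (e i) (e j) (e k) p in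
  let T l i j k := tensorT4 f D Dbar nabla (e l) (e i) (e j) (e k) p in
  [/\ forall i j k l,
        dh i j k l =
        T l i j k + 4^-1 * \sum_m (w l i m * h m j k + w l j m * h i m k
                                   + w l k m * h i j m),
      totally_symmetric T &
      trace_free T].
Proof.
move=> h dh w T; split.
- move=> i j k l.
  exact: (nabla_cubic_tensorT4 D_lc f_imm f_lag Dbar_pc nabla_lc U_open e_frame Up).
- apply: totally_symmetricP => l i j k.
  + exact: (tensorT4_sym01 D_lc f_imm f_lag Dbar_pc nabla_lc U_open e_frame Up).
  + exact: (tensorT4_sym12 D_lc f_imm f_lag Dbar_pc nabla_lc U_open e_frame Up).
  + exact: (tensorT4_sym23 D_lc f_imm f_lag Dbar_pc nabla_lc U_open e_frame Up).
- move=> j k.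
  exact: (tensorT4_trace D_lc f_imm f_lag Dbar_pc nabla_lc U_open e_frame Up).
Qed.
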